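(* Let $n\ge 3$, let $Q$ be the reduced quiver of the GL$_2$-dimer of an arbitrary triangulation of the convex $n$-gon, and let $Q_F(n)$ be the reduced quiver of the GL$_2$-dimer of a fan triangulation of the $n$-gon. Let $e_{b'}$ and $e_b$ be the sums of the boundary idempotents of $\Lambda_Q$ and $\Lambda_{Q_F(n)}$, respectively. Then there is an algebra isomorphism $$e_{b'}\Lambda_Qe_{b'}\cong e_b\Lambda_{Q_F(n)}e_b.$$
   Context: Paths are composed from left to right. The dimer algebra of a dimer model with boundary $Q$ is $\Lambda_Q=\mathbb{C}Q/\langle\partial W\rangle$, where $\partial W$ consists of the relations $p_1\cdots p_k=q_1\cdots q_l$, one for each internal arrow $\alpha$ lying on the anticlockwise face boundary $\alpha p_1\cdots p_k$ and the clockwise face boundary $\alpha q_1\cdots q_l$; boundary vertices are those incident with arrows lying in only one face. A fan triangulation is one whose diagonals all share a common polygon vertex. GL$_2$-dimer quiver: for a triangulation $T$ of a convex $n$-gon $P$, subdivide each triangle of $T$ by the midlines into $4$ small triangles; put a black node at the midpoint of each half-side of each triangle and in each downward (middle) small triangle, and a white node in each of the three upward small triangles; join nodes of different colour lying in the same small triangle or in small triangles sharing a side. The quiver has a vertex for each component of the complement of this graph in $P$ and an arrow across each edge, oriented with the white endpoint on its left; white nodes give anticlockwise faces, black nodes of degree $\ge 2$ clockwise faces; 2-cycles of internal arrows are removed via the relations (reduced quiver). *)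

(* Defs.v *)
From HB Require Import structures.
From mathcomp Require Import all_boot all_order all_algebra.
Set Implicit Arguments. Unset Strict Implicit. Unset Printing Implicit Defensive.
Import GRing.Theory.

(* A dimer model with boundary, given as a quiver (vertex set, arrow set,
   source/target maps) together with its anticlockwise and clockwise face
   boundaries, each given as a cyclic sequence of arrows (composed left
   to right). *)
Record dimer (V A : finType) := Dimer {
  dverts : {set V};
  darrs  : {set A};
  dsrc   : A -> V;
  dtgt   : A -> V;
  dacw   : seq (seq A);
  dcw    : seq (seq A) }.

Section DimerAlgebra.
Variables (K : fieldType) (V A : finType) (Q : dimer V A).
Local Open Scope ring_scope.

(* A path: its start vertex and its sequence of arrows (left to right);
   the empty arrow sequence is the trivial path (idempotent) at the vertex. *)
Definition qpath := (V * seq A)%type.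

Definition pstart (p : qpath) : V := p.1.
Definition pend (p : qpath) : V := last p.1 [seq dtgt Q a | a <- p.2].

Fixpoint walk (v : V) (s : seq A) : bool :=
  if s is a :: s' then (dsrc Q a == v) && walk (dtgt Q a) s' else true.

Definition valid_path (p : qpath) : bool :=
  [&& p.1 \in dverts Q, all (fun a => a \in darrs Q) p.2 & walk p.1 p.2].

(* Elements of the path algebra K Q: finite formal K-linear combinations
   of paths. *)
Definition fsum := seq (K * qpath).

Definition coef (x : fsum) (p : qpath) : K := \sum_(t <- x | t.2 == p) t.1.
Definition fs_equal (x y : fsum) : Prop := forall p, coef x p = coef y p.
Definition fs_add (x y : fsum) : fsum := x ++ y.
Definition fs_scale (c : K) (x : fsum) : fsum := [seq (c * t.1, t.2) | t <- x].
Definition fs_opp (x : fsum) : fsum := fs_scale (-1) x.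
Definition fs_mul (x y : fsum) : fsum :=
  [seq (s.1 * t.1, (s.2.1, s.2.2 ++ t.2.2))
     | s <- x, t <- [seq t <- y | pend s.2 == pstart t.2]].

Definition face_rest (f : seq A) (a : A) : seq A :=
  drop (index a f).+1 f ++ take (index a f) f.

(* The relations dW: for each internal arrow a, lying on an anticlockwise
   face a p and a clockwise face a q, the relation p = q (paths from
   tgt a to src a). *)
Definition rels : seq (qpath * qpath) :=
  [seq ((dtgt Q a, face_rest fg.1 a), (dtgt Q a, face_rest fg.2 a))
     | a <- enum (darrs Q),
       fg <- [seq fg <- allpairs pair (dacw Q) (dcw Q)
                | (a \in fg.1) && (a \in fg.2)]].

Definition rel_elt (r : qpath * qpath) : fsum := [:: (1, r.1); (-1, r.2)].

Record ideal_term := IdealTerm { it_c : K; it_l : qpath; it_r : qpath * qpath; it_u : qpath }.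

Definition ideal_term_elt (t : ideal_term) : fsum :=
  fs_scale (it_c t) (fs_mul (fs_mul [:: (1, it_l t)] (rel_elt (it_r t))) [:: (1, it_u t)]).

Definition in_ideal (x : fsum) : Prop :=
  exists l : seq ideal_term,
    all (fun t => [&& valid_path (it_l t), it_r t \in rels & valid_path (it_u t)]) l
    /\ fs_equal x (flatten [seq ideal_term_elt t | t <- l]).

Definition lequiv (x y : fsum) : Prop := in_ideal (fs_add x (fs_opp y)).

Definition nfaces (a : A) : nat := count (fun f => a \in f) (dacw Q ++ dcw Q).
Definition is_bvert (v : V) : bool :=
  [exists a in darrs Q, (nfaces a == 1%N) && ((dsrc Q a == v) || (dtgt Q a == v))].

Definition ebound : fsum :=
  [seq (1, (v, [::])) | v <- enum [set v in dverts Q | is_bvert v]].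

(* representatives of elements of e_b Lambda_Q e_b : combinations of valid
   paths starting and ending at boundary vertices *)
Definition corner (x : fsum) : bool :=
  all (fun t => [&& valid_path t.2, is_bvert (pstart t.2) & is_bvert (pend t.2)]) x.

End DimerAlgebra.

(* A map on representatives inducing a unital K-algebra homomorphism
   e_b Lambda_Q e_b -> e_b' Lambda_Q' e_b'. *)
Definition corner_alg_hom (K : fieldType) (V A V' A' : finType)
  (Q : dimer V A) (Q' : dimer V' A') (phi : fsum K V A -> fsum K V' A') : Prop :=
  ((forall x, corner Q x -> corner Q' (phi x)) /\
   (forall x y, corner Q x -> corner Q y -> lequiv Q x y -> lequiv Q' (phi x) (phi y))) /\
  [/\
      (forall x y, corner Q x -> corner Q y ->
          lequiv Q' (phi (fs_add x y)) (fs_add (phi x) (phi y))),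
      (forall c x, corner Q x -> lequiv Q' (phi (fs_scale c x)) (fs_scale c (phi x))),
      (forall x y, corner Q x -> corner Q y ->
          lequiv Q' (phi (fs_mul Q x y)) (fs_mul Q' (phi x) (phi y)))
    & lequiv Q' (phi (ebound K Q)) (ebound K Q')].

Definition corner_alg_iso (K : fieldType) (V A V' A' : finType)
  (Q : dimer V A) (Q' : dimer V' A') : Prop :=
  exists (phi : fsum K V A -> fsum K V' A') (psi : fsum K V' A' -> fsum K V A),
    [/\ corner_alg_hom Q Q' phi, corner_alg_hom Q' Q psi,
        (forall x, corner Q x -> lequiv Q (psi (phi x)) x)
      & (forall y, corner Q' y -> lequiv Q' (phi (psi y)) y)].

(* Triangulations of the convex n-gon with vertices 0,...,n-1 in        *)
(* anticlockwise order.  Segments are pairs (i,j) with i < j.           *)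

Definition seg n (i j : 'I_n) : 'I_n * 'I_n := if (i < j)%N then (i, j) else (j, i).

Definition is_side n (s : 'I_n * 'I_n) : bool :=
  (s.1 < s.2)%N && ((val s.2 == (val s.1).+1) || ((val s.1 == 0%N) && (val s.2 == n.-1))).

Definition is_diag n (s : 'I_n * 'I_n) : bool := (s.1 < s.2)%N && ~~ is_side s.

Definition crossing n (d e : 'I_n * 'I_n) : bool :=
  [&& (d.1 < e.1)%N, (e.1 < d.2)%N & (d.2 < e.2)%N]
  || [&& (e.1 < d.1)%N, (d.1 < e.2)%N & (e.2 < d.2)%N].

Definition noncrossing n (D : {set 'I_n * 'I_n}) : bool :=
  [forall d in D, is_diag d] && [forall d in D, forall e in D, ~~ crossing d e].

Definition triangulation n (D : {set 'I_n * 'I_n}) : bool :=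
  noncrossing D &&
  [forall D' : {set 'I_n * 'I_n}, (D \subset D') && noncrossing D' ==> (D' == D)].

Definition fan_triangulation n (D : {set 'I_n * 'I_n}) : bool :=
  triangulation D && [exists v : 'I_n, forall d in D, (d.1 == v) || (d.2 == v)].

Definition is_seg n (D : {set 'I_n * 'I_n}) (s : 'I_n * 'I_n) : bool :=
  is_side s || (s \in D).

Definition is_tri n (D : {set 'I_n * 'I_n}) (t : 'I_n * 'I_n * 'I_n) : bool :=
  let: (a, b, c) := t in
  [&& (a < b)%N, (b < c)%N, is_seg D (a, b), is_seg D (b, c) & is_seg D (a, c)].

(* (x,y,z): a triangle with its corners listed in anticlockwise order *)
Definition is_ctri n (D : {set 'I_n * 'I_n}) (t : 'I_n * 'I_n * 'I_n) : bool :=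
  let: (x, y, z) := t in [|| is_tri D (x, y, z), is_tri D (y, z, x) | is_tri D (z, x, y)].

(* The reduced quiver of the GL_2-dimer of a triangulation D.           *)
(* Vertices (components of the complement of the dimer graph):          *)
(*   inl v : the region around polygon vertex v,                         *)
(*   inr s : the region around the midpoint of the segment s             *)
(*           (side or diagonal).                                         *)
(* Arrows:                                                               *)
(*   inl (x,y,z)  : for a triangle with corners x,y,z anticlockwise, the *)
(*                  arrow across the edge (white node at corner x)--     *)
(*                  (middle black node), from region of seg xy to seg xz; *)
(*   inr (inl v)  : boundary arrow  (vertex v) -> (side v,v+1);          *)
(*   inr (inr v)  : boundary arrow  (side v-1,v) -> (vertex v).          *)
(* The arrows across the edges to the half-side black nodes of diagonals *)
(* form the 2-cycles removed in the reduction.                           *)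

Definition gl2V n := ('I_n + ('I_n * 'I_n))%type.
Definition gl2A n := (('I_n * 'I_n * 'I_n) + ('I_n + 'I_n))%type.

Definition gl2_src n (a : gl2A n) : gl2V n :=
  match a with
  | inl (x, y, z) => inr (seg x y)
  | inr (inl v) => inl v
  | inr (inr v) => inr (seg (ord_pred v) v)
  end.

Definition gl2_tgt n (a : gl2A n) : gl2V n :=
  match a with
  | inl (x, y, z) => inr (seg x z)
  | inr (inl v) => inr (seg v (ordS v))
  | inr (inr v) => inl v
  end.

Definition rpos n (v u : 'I_n) : nat := ((u + n - v) %% n)%N.

(* polygon vertices joined to v by a side or diagonal, in anticlockwise
   order starting from v+1 and ending at v-1 *)
Definition nbrs n (D : {set 'I_n * 'I_n}) (v : 'I_n) : seq 'I_n :=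
  sort (fun a b => (rpos v a <= rpos v b)%N) [seq u <- enum 'I_n | is_seg D (seg v u)].

(* the anticlockwise face around polygon vertex v (the merged white
   faces of the corners at v after reduction) *)
Definition vface n (D : {set 'I_n * 'I_n}) (v : 'I_n) : seq (gl2A n) :=
  inr (inl v) ::
  [seq inl (v, p.1, p.2) | p <- zip (nbrs D v) (behead (nbrs D v))]
  ++ [:: inr (inr v)].

(* the clockwise face of a triangle (its middle black node) *)
Definition tface n (t : 'I_n * 'I_n * 'I_n) : seq (gl2A n) :=
  let: (a, b, c) := t in [:: inl (a, b, c); inl (c, a, b); inl (b, c, a)].

Definition gl2_dimer n (D : {set 'I_n * 'I_n}) : dimer (gl2V n) (gl2A n) :=
  {| dverts := [set x : gl2V n | if x is inr s then is_seg D s else true];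
     darrs := [set a : gl2A n | if a is inl t then is_ctri D t else true];
     dsrc := @gl2_src n;
     dtgt := @gl2_tgt n;
     dacw := [seq vface D v | v <- enum 'I_n];
     dcw := [seq tface t | t <- enum [set t | is_tri D t]] |}.

(* Main.v *)
(* A polygon vertex v of the quiver is regarded as the degenerate segment {v,v}.
   Every arrow then moves one endpoint of a segment anticlockwise without passing
   the other one; its weight is the number of polygon sides swept.  Every face
   has weight n, so weight is an invariant of paths modulo the relations, and it
   does not see the triangulation along the boundary.  Conversely, for an
   arbitrary triangulation a path from a side {v,v+1} to {c,d}, v <= c < d < v+n,
   equals a power of the face loop at {v,v+1} followed by the canonical path that
   walks along the boundary to {c,c+1} and then turns about c until it reaches
   {c,d}.  Hence boundary paths are classified, in both algebras, by start, end
   and weight, and the same weights occur; matching paths by these data is the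
   isomorphism. *)
Require Import Defs.
From HB Require Import structures.
From mathcomp Require Import all_boot all_order all_algebra zify ring.
Set Implicit Arguments. Unset Strict Implicit. Unset Printing Implicit Defensive.
Import GRing.Theory.

(** * Path classes *)

(** Equality in a corner is reduced to coordinates: [csum] adds the coefficients of all paths with a
    given start, end and weight. Homogeneity of the relations makes these sums vanish on the ideal;
    completeness of the weight on boundary paths makes them the only invariants. Multiplicativity
    and invertibility of the matching of paths then become identities between coefficients. A
    boundary path may run through the interior, where the two quivers differ, so the normal form is
    proved for an arbitrary end vertex, by appending one arrow at a time, and only the start is kept
    on a side. This induction closes because the face loop can be moved back to the start of a
    canonical path; as it weighs [n], its exponent is read off from the total weight. *)

Section PathClasses.
Variables (K : fieldType) (V A : finType) (Q : dimer V A) (wt : A -> nat).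
Local Open Scope ring_scope.
Implicit Types (x y z : fsum K V A) (p q : qpath V A) (s u : seq A) (v w : V).

Definition pweight s : nat := sumn (map wt s).

Lemma pweight_cat s t : pweight (s ++ t) = (pweight s + pweight t)%N.
Proof. by rewrite /pweight map_cat sumn_cat. Qed.

Lemma pend_cat v s t : pend Q (v, s ++ t) = pend Q (pend Q (v, s), t).
Proof. by rewrite /pend /= map_cat last_cat. Qed.

Lemma pend_cons v a s : pend Q (v, a :: s) = pend Q (dtgt Q a, s).
Proof. by []. Qed.

Lemma walk_cat v s t : walk Q v (s ++ t) = walk Q v s && walk Q (pend Q (v, s)) t.
Proof. by elim: s v => //= a s IH v; rewrite IH andbA. Qed.

(** [valid_path] tests only its start vertex against [dverts]; this condition covers the
    intermediate vertices, so that a valid path may be cut anywhere. *)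
Definition closed_arrows := forall a, a \in darrs Q -> dtgt Q a \in dverts Q.

Lemma pend_dverts v s : closed_arrows -> valid_path Q (v, s) -> pend Q (v, s) \in dverts Q.
Proof.
move=> cl; elim: s v => [|a s IH] v; first by case/and3P.
case/and3P=> /= _ /andP[Da Ds] /andP[_ Ws]; rewrite pend_cons.
by apply: IH; apply/and3P; split; rewrite //= cl.
Qed.

Lemma valid_cat v s t : closed_arrows ->
  valid_path Q (v, s ++ t) = valid_path Q (v, s) && valid_path Q (pend Q (v, s), t).
Proof.
move=> cl; apply/idP/idP.
  case/and3P=> /= Vv; rewrite all_cat walk_cat => /andP[As At] /andP[Ws Wt].
  have vs : valid_path Q (v, s) by apply/and3P.
  by rewrite vs /=; apply/and3P; split=> //=; apply: pend_dverts cl vs.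
case/andP=> /and3P[/= Vv As Ws] /and3P[/= _ At Wt].
by apply/and3P; rewrite /= all_cat walk_cat; split=> //; apply/andP.
Qed.

Lemma coef_cat x y p : coef (x ++ y) p = coef x p + coef y p.
Proof. by rewrite /coef big_cat. Qed.

Lemma in_ideal0 : in_ideal Q ([::] : fsum K V A).
Proof. by exists [::]. Qed.

Lemma in_ideal_eq x y : fs_equal x y -> in_ideal Q y -> in_ideal Q x.
Proof. by move=> xy [l [al yl]]; exists l; split=> // p; rewrite xy. Qed.

Lemma in_ideal_cat x y : in_ideal Q x -> in_ideal Q y -> in_ideal Q (x ++ y).
Proof.
move=> [l [al xl]] [m [am ym]]; exists (l ++ m); split; first by rewrite all_cat al.
by move=> p; rewrite map_cat flatten_cat !coef_cat xl ym.
Qed.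

(** The endpoint conditions matter because [fs_mul] discards pairs that do not compose: they
    guarantee that multiplying the relation by [l] and [u] yields the difference of the two
    displayed paths and not the empty sum. *)
Inductive peq v : seq A -> seq A -> Prop :=
| peq_rel l r u of r \in rels Q & valid_path Q (v, l)
    & pend Q (v, l) = r.1.1 & pend Q (v, l) = r.2.1
    & valid_path Q (pend Q r.1, u) & pend Q r.1 = pend Q r.2 :
    peq v (l ++ r.1.2 ++ u) (l ++ r.2.2 ++ u)
| peq_refl s : peq v s s
| peq_sym s t of peq v s t : peq v t s
| peq_trans s t u of peq v s t & peq v t u : peq v s u.

Lemma peq_pend v s t : peq v s t -> pend Q (v, s) = pend Q (v, t).
Proof.
elim=> {s t} [l [[r1 s1] [r2 s2]] u /= _ _ e1 e2 _ e||//|s t u _ -> _ ->] //.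
by rewrite !pend_cat e1 e -e1 e2.
Qed.

Lemma peq_catr v s t u : closed_arrows ->
  peq v s t -> valid_path Q (pend Q (v, s), u) -> peq v (s ++ u) (t ++ u).
Proof.
move=> cl; elim=> {s t}
  [l r u' rQ vl e1 e2 vu e|s|s t st IH|s t w st IH1 tw IH2] vend.
- rewrite -!catA; apply: peq_rel => //; rewrite valid_cat // vu /=.
  by move: vend; rewrite 2!pend_cat e1 -surjective_pairing.
- exact: peq_refl.
- by apply: peq_sym; apply: IH; rewrite (peq_pend st).
- apply: peq_trans (IH1 vend) _; apply: IH2; by rewrite -(peq_pend st).
Qed.

Lemma peq_catl v l s t : closed_arrows -> valid_path Q (v, l) ->
  peq (pend Q (v, l)) s t -> peq v (l ++ s) (l ++ t).
Proof.
move=> cl vl; elim=> {s t}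
  [l' r u' rQ vl' e1 e2 vu e|s|s t st IH|s t w st IH1 tw IH2].
- rewrite !(catA l); apply: peq_rel => //; rewrite ?pend_cat //.
  by rewrite valid_cat // vl.
- exact: peq_refl.
- exact: peq_sym.
- exact: peq_trans IH1 IH2.
Qed.

Lemma peq_in_ideal v s t (c : K) :
  peq v s t -> in_ideal Q [:: (c, (v, s)); (- c, (v, t))].
Proof.
move=> st; elim: st c => {s t}
  [l r u rQ vl e1 e2 vu e|s|s t _ IH|s t u _ IH1 _ IH2] c.
- exists [:: IdealTerm c (v, l) r (pend Q r.1, u)]; split=> /=.
    by rewrite vl rQ vu.
  move: r e1 e2 e {rQ vu} => [[r1 s1] [r2 s2]] /= e1 e2 e.
  have er : r2 = r1 by rewrite -e1 e2.
  rewrite {r2 e2}er in e *; rewrite /ideal_term_elt /= /fs_mul /= /pstart e1 /= eqxx /=.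
  rewrite (pend_cat v l s1) e1 (pend_cat v l s2) e1 -e eqxx /=.
  by move=> p; rewrite !mul1r !mulr1 mulrN1 -!catA.
- apply: in_ideal_eq in_ideal0 => p.
  by rewrite /coef !big_cons !big_nil /=; case: eqP; rewrite ?addr0 ?subrr.
- apply: in_ideal_eq (IH (- c)) => p; rewrite opprK /coef !big_cons !big_nil /=.
  by case: eqP; case: eqP; rewrite ?addr0 // addrC.
- apply: in_ideal_eq (in_ideal_cat (IH1 c) (IH2 c)) => p.
  rewrite /coef !big_cons !big_nil /=.
  by case: (_ == p); case: (_ == p); case: (_ == p); ring.
Qed.

Definition pclass p := (pstart p, pend Q p, pweight p.2).

Definition csum x (k : V * V * nat) : K := \sum_(t <- x | pclass t.2 == k) t.1.

Lemma csum_cat x y k : csum (x ++ y) k = csum x k + csum y k.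
Proof. by rewrite /csum big_cat. Qed.

Lemma csum_opp x k : csum (fs_opp x) k = - csum x k.
Proof.
rewrite /csum /fs_opp /fs_scale big_map -sumrN /=.
by apply: eq_bigr => t _; rewrite mulN1r.
Qed.

(** [fs_equal] compares coefficients, whereas [csum] runs over the terms of a representative.
    Regrouping along a duplicate-free list that contains the support shows that [csum] depends on
    the coefficients only. *)
Lemma csum_coef x k (r : seq (qpath V A)) :
  uniq r -> {subset [seq t.2 | t <- x] <= r} ->
  csum x k = \sum_(p <- r | pclass p == k) coef x p.
Proof.
move=> Ur xr; rewrite /csum /coef (exchange_big_dep (fun t => pclass t.2 == k)) /=; last first.
  by move=> p t pk /eqP->.
rewrite [LHS]big_seq_cond [RHS]big_seq_cond; apply: eq_bigr => t /andP[tx tk].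
rewrite -big_filter (_ : [seq _ <- r | _] = [:: t.2]) ?big_seq1 //.
rewrite -(@filter_pred1_uniq _ r t.2) //; last by apply: xr; apply: map_f.
by apply: eq_filter => p /=; rewrite [LHS]andbC eq_sym; case: eqP => //= ->; rewrite tk.
Qed.

Lemma csum_eq x y : fs_equal x y -> csum x =1 csum y.
Proof.
move=> xy k; set r := undup ([seq t.2 | t <- x] ++ [seq t.2 | t <- y]).
rewrite !(@csum_coef _ _ r) ?undup_uniq //; first exact: eq_bigr.
  by move=> p py; rewrite mem_undup mem_cat py orbT.
by move=> p py; rewrite mem_undup mem_cat py.
Qed.

Definition homogeneous_rels := forall r, r \in rels Q -> pclass r.1 = pclass r.2.

Lemma peq_pweight v s t : homogeneous_rels -> peq v s t -> pweight s = pweight t.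
Proof.
move=> hom; elim=> {s t} [l r u /hom[_ _ e] _ _ _ _ _|//|//|s t u _ -> _ ->] //.
by rewrite !pweight_cat e.
Qed.

(** A generator of the ideal is either empty, when its factors do not compose, or a difference of
    two paths of one class with opposite coefficients. *)
Lemma csum_ideal x : homogeneous_rels -> in_ideal Q x -> forall k, csum x k = 0.
Proof.
move=> hom [l [al xl]] k; rewrite (csum_eq xl) {x xl}.
elim: l al => [_|[c [v l] [[r1 s1] [r2 s2]] [w u]] ts IH /=]; first by rewrite /csum big_nil.
case/andP=> /and3P[_ /hom[] /= e1 e2 e3 _] /IH{}IH; rewrite csum_cat IH addr0.
rewrite /ideal_term_elt /fs_mul /= /pstart /= -e1.
have e4 : pend Q (r1, s2) = pend Q (r1, s1) by rewrite e2 e1.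
case: eqP => [e|_]; last by rewrite /csum big_nil.
rewrite /= !pend_cat e e4; case: eqP => [e'|_]; last by rewrite /csum big_nil.
rewrite /csum !big_cons big_nil /= /pclass /pstart /= !pend_cat e e4 !pweight_cat e3.
by case: eqP; rewrite ?addr0 // !mul1r !mulr1 mulrN1 subrr.
Qed.

Definition bpath p := [&& valid_path Q p, is_bvert Q (pstart p) & is_bvert Q (pend Q p)].

Definition complete_weight := forall v s t,
  bpath (v, s) -> bpath (v, t) -> pclass (v, s) = pclass (v, t) -> peq v s t.

(* Peel off one class at a time: inside a class all paths are congruent to its
   first member, whose total coefficient vanishes. *)
Lemma in_ideal_csum x : complete_weight -> corner Q x -> (forall k, csum x k = 0) ->
  in_ideal Q x.
Proof.
move=> comp; elim: {x}(size x) {-2}x (leqnn (size x)) => [|m IH] x.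
  by case: x => // _ _ _; exact: in_ideal0.
case: x => [|[c [v s]] x']; first by move=> *; exact: in_ideal0.
set x := _ :: x' => szx cx sx.
pose P (t : K * qpath V A) := pclass t.2 == pclass (v, s).
have split_x : fs_equal x (filter P x ++ filter (predC P) x).
  by move=> p; rewrite /coef; apply: perm_big; rewrite perm_sym perm_filterC.
apply: (in_ideal_eq split_x); apply: in_ideal_cat.
  have sP : \sum_(t <- filter P x) t.1 = 0 by rewrite big_filter; exact: sx.
  have [cvs bvs] : corner Q (filter P x) /\ bpath (v, s).
    split; last by case/andP: cx.
    apply/allP=> t; rewrite mem_filter => /andP[_]; exact: (allP cx).
  have aP : all P (filter P x) by apply: filter_all.
  move: (filter P x) sP cvs aP => y sy cy ay.
  (* A vanishing total is not inherited by the tail of [y]; subtracting the total at the path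
     [(v, s)] gives a claim that is. *)
  suff {sy} H : in_ideal Q (y ++ [:: (- \sum_(t <- y) t.1, (v, s))]).
    apply: in_ideal_eq H => p; rewrite coef_cat sy oppr0 /coef !big_cons big_nil.
    by case: eqP; rewrite !addr0.
  elim: y cy ay => [|[d [v' t]] y IHy] /=.
    move=> _ _; apply: in_ideal_eq in_ideal0 => p.
    by rewrite /coef !big_cons !big_nil oppr0; case: eqP; rewrite ?addr0.
  case/andP=> bt cy /andP[/eqP kt] ay.
  have ev : v' = v by case: kt.
  rewrite {}ev in kt bt *.
  apply: in_ideal_eq (in_ideal_cat (peq_in_ideal d (comp _ _ _ bt bvs kt)) (IHy cy ay)) => p.
  rewrite /coef !big_cons !big_cat /= !big_cons !big_nil /= opprD.
  by case: (_ == p); case: (_ == p); ring.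
apply: IH.
- rewrite size_filter /= /P eqxx /= add0n.
  by apply: leq_trans (count_size _ _) _.
- by apply/allP=> t; rewrite mem_filter => /andP[_]; exact: (allP cx).
- move=> k; have := sx k; rewrite (csum_eq split_x) csum_cat.
  have -> : csum (filter P x) k = if k == pclass (v, s) then csum x k else 0.
    rewrite /csum big_filter_cond; case: eqP => [->|ne].
      by apply: eq_bigl => t; rewrite andbb.
    by apply: big1 => t /andP[/eqP -> /eqP e]; case: ne.
  by rewrite sx if_same add0r.
Qed.

Lemma corner_cat x y : corner Q (x ++ y) = corner Q x && corner Q y.
Proof. exact: all_cat. Qed.

Lemma corner_scale c x : corner Q (fs_scale c x) = corner Q x.
Proof. by rewrite /corner all_map. Qed.

Lemma lequivP x y : homogeneous_rels -> complete_weight ->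
  corner Q x -> corner Q y -> lequiv Q x y <-> csum x =1 csum y.
Proof.
move=> hom comp cx cy; split=> [xy k|xy].
  have := csum_ideal hom xy k.
  by rewrite csum_cat csum_opp => /eqP; rewrite subr_eq0 => /eqP.
apply: in_ideal_csum => //.
  by rewrite corner_cat cx /fs_opp corner_scale.
by move=> k; rewrite csum_cat csum_opp xy subrr.
Qed.

End PathClasses.

(** * Isomorphisms from matching path classes *)

Section WeightTransport.
Variables (K : fieldType) (V A : finType) (wt : A -> nat).
Local Open Scope ring_scope.
Implicit Types (Q : dimer V A) (x y : fsum K V A) (p q : qpath V A).

Definition realizes Q Q' :=
  forall p, bpath Q p -> exists q, bpath Q' q && (pclass Q' wt q == pclass Q wt p).

(** The condition on the right sees the factors only through their classes, which makes transport
    multiplicative. *)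
Lemma csum_mul Q x y k :
  csum Q wt (fs_mul Q x y) k =
  \sum_(d <- x) \sum_(e <- y | (pend Q d.2 == pstart e.2) &&
     ((pstart d.2, pend Q e.2, (pweight wt d.2.2 + pweight wt e.2.2)%N) == k)) d.1 * e.1.
Proof.
rewrite /csum /fs_mul big_mkcond big_allpairs_dep; apply: eq_bigr => d _.
rewrite big_filter big_mkcondr; apply: eq_bigr => e /eqP de /=.
by rewrite /pclass pweight_cat pend_cat -surjective_pairing de -surjective_pairing.
Qed.

Lemma corner_mul Q x y : closed_arrows Q -> corner Q x -> corner Q y ->
  corner Q (fs_mul Q x y).
Proof.
move=> cl cx cy; apply/allP => z /allpairsPdep[d [e [dx]]].
rewrite mem_filter => /andP[/eqP de ey] {z}->.
have /and3P[vd bd _] := allP cx _ dx; have /and3P[ve _ be] := allP cy _ ey.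
rewrite /= /pstart bd pend_cat -surjective_pairing de -surjective_pairing be.
by rewrite valid_cat // -surjective_pairing vd de -surjective_pairing ve.
Qed.

Lemma ebound_corner Q : corner Q (ebound K Q).
Proof.
apply/allP => z /mapP[v + {z}->]; rewrite mem_enum inE => /andP[vQ bv].
by rewrite /= /valid_path /pstart /pend /= vQ bv.
Qed.

Section Transport.
Variables (Q Q' : dimer V A).
Hypotheses (clQ : closed_arrows Q) (clQ' : closed_arrows Q').
Hypotheses (homQ : homogeneous_rels Q wt) (homQ' : homogeneous_rels Q' wt).
Hypotheses (compQ : complete_weight Q wt) (compQ' : complete_weight Q' wt).
Hypothesis bvE : is_bvert Q =1 is_bvert Q'.
Hypotheses (QQ' : realizes Q Q') (Q'Q : realizes Q' Q).

(** [xchoose] picks some partner in the same class; by completeness in [Q'] the choice does not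
    matter modulo the ideal. Off the boundary paths [p] is a default value that no [corner] element
    meets. *)
Definition transport_path p : qpath V A :=
  if @idP (bpath Q p) is ReflectT b then xchoose (QQ' b) else p.

Lemma transport_pathP p : bpath Q p ->
  bpath Q' (transport_path p) /\ pclass Q' wt (transport_path p) = pclass Q wt p.
Proof.
rewrite /transport_path; case: {-}_ / idP => // b _.
by have /andP[-> /eqP->] := xchooseP (QQ' b).
Qed.

Definition transport x : fsum K V A := [seq (d.1, transport_path d.2) | d <- x].

Lemma transport_corner x : corner Q x -> corner Q' (transport x).
Proof.
move=> cx; apply/allP => z /mapP[d dx {z}->].
exact: (transport_pathP (allP cx _ dx)).1.
Qed.

Lemma csum_transport x : corner Q x -> csum Q' wt (transport x) =1 csum Q wt x.
Proof.
move=> cx k; rewrite /csum big_map big_seq_cond [RHS]big_seq_cond /=.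
apply: eq_bigl => d; apply: andb_id2l => dx.
by rewrite (transport_pathP (allP cx _ dx)).2.
Qed.

Lemma transport_hom : corner_alg_hom Q Q' transport.
Proof.
have eqvP := lequivP homQ' compQ'.
do 2!split.
- exact: transport_corner.
- move=> x y cx cy /(lequivP homQ compQ cx cy) xy.
  by apply/eqvP; rewrite ?transport_corner // => k; rewrite !csum_transport.
- move=> x y cx cy; have cxy : corner Q (x ++ y) by rewrite corner_cat cx.
  apply/eqvP; rewrite ?corner_cat ?transport_corner // => k.
  by rewrite csum_cat !csum_transport // csum_cat.
- move=> c x cx; apply/eqvP; rewrite ?corner_scale ?transport_corner ?corner_scale //.
  by move=> k; rewrite /transport /fs_scale -!map_comp.
- move=> x y cx cy; have cxy := corner_mul clQ cx cy.
  have cx' := transport_corner cx; have cy' := transport_corner cy.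
  apply/eqvP; rewrite ?corner_mul ?transport_corner // => k.
  rewrite csum_transport // !csum_mul big_map big_seq [RHS]big_seq.
  apply: eq_bigr => d dx; rewrite big_map big_seq_cond [RHS]big_seq_cond /=.
  apply: eq_bigl => e; apply: andb_id2l => ey.
  have [_] := transport_pathP (allP cx _ dx); have [_] := transport_pathP (allP cy _ ey).
  by case=> -> -> -> [-> -> ->].
- apply/eqvP; rewrite ?transport_corner ?ebound_corner // => k.
  rewrite csum_transport ?ebound_corner // /ebound.
  (* A boundary vertex of one quiver belongs to the other because the partner of its trivial path
     starts there. *)
  have -> : [set v in dverts Q' | is_bvert Q' v] = [set v in dverts Q | is_bvert Q v].
    apply/setP=> v; rewrite !inE -bvE; apply: andb_id2r => bv; apply/idP/idP => vQ.
      have [|[w s] /andP[/and3P[/andP[+ _] _ _] /eqP[+ _ _]]] := @Q'Q (v, [::]).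
        by apply/and3P; rewrite /valid_path /pstart /pend /= vQ -bvE.
      by rewrite /pstart /= => + <-.
    have [|[w s] /andP[/and3P[/andP[+ _] _ _] /eqP[+ _ _]]] := @QQ' (v, [::]).
      by apply/and3P; rewrite /valid_path /pstart /pend /= vQ bv.
    by rewrite /pstart /= => + <-.
  by rewrite /csum !big_map.
Qed.

End Transport.

(** The two transports need not be inverse on representatives, but both preserve [csum], which
    decides equality in the corner. *)
Theorem weighted_corner_iso Q Q' :
  closed_arrows Q -> closed_arrows Q' ->
  homogeneous_rels Q wt -> homogeneous_rels Q' wt ->
  complete_weight Q wt -> complete_weight Q' wt ->
  is_bvert Q =1 is_bvert Q' -> realizes Q Q' -> realizes Q' Q ->
  corner_alg_iso K Q Q'.
Proof.
move=> cl cl' hom hom' comp comp' bvE QQ' Q'Q.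
exists (transport QQ'), (transport Q'Q); split.
- exact: transport_hom.
- by apply: transport_hom => // v; rewrite bvE.
- move=> x cx; apply/(lequivP hom comp) => //; first by do 2!apply: transport_corner.
  by move=> k; rewrite !csum_transport // transport_corner.
- move=> x cx; apply/(lequivP hom' comp') => //; first by do 2!apply: transport_corner.
  by move=> k; rewrite !csum_transport // transport_corner.
Qed.

End WeightTransport.

(** * Triangulated polygons *)

Section CyclicIndices.
Variables (n : nat) (n_gt0 : (0 < n)%N).
Implicit Types (i j k : nat) (a b : 'I_n).

(* Natural numbers label polygon vertices modulo n, so that cyclically ordered
   vertices become increasing numbers in a window of length n. *)
Definition pt i : 'I_n := Ordinal (ltn_pmod i n_gt0).

Lemma ptDn i : pt (i + n) = pt i.
Proof. by apply: val_inj; rewrite /= /pt /= modnDr. Qed.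

Lemma pt_val a : pt a = a.
Proof. by apply: val_inj; rewrite /= /pt /= modn_small. Qed.

(** Inside one window at most one wrap past 0 occurs; the two cases are linear and free of [%%],
    ready for [lia]. *)
Lemma val_pt_cases i j : (i <= j < i + n)%N ->
  ((j - i + pt i < n) /\ pt j = pt i + (j - i) :> nat)%N \/
  ((n <= j - i + pt i) /\ pt j = pt i + (j - i) - n :> nat)%N.
Proof.
move=> ij; have ri := ltn_ord (pt i); rewrite /pt /= in ri *.
have -> : (j %% n = (i %% n + (j - i)) %% n)%N by rewrite modnDml subnKC //; lia.
case: (ltnP (j - i + i %% n) n) => h; [left|right]; split=> //.
  by rewrite modn_small // addnC.
rewrite -[X in (X %% n)%N](@subnK n); last by lia.
by rewrite modnDr modn_small //; lia.
Qed.

Lemma pt_inj i j : (i <= j < i + n)%N -> pt i = pt j -> i = j.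
Proof. by move=> ij e; have := val_pt_cases ij; rewrite e; have := ltn_ord (pt j); lia. Qed.

Lemma pt_neq i j : (i < j < i + n)%N -> pt i != pt j.
Proof.
move=> ij; apply/eqP => e; have ij' : (i <= j < i + n)%N by lia.
by have := pt_inj ij' e; lia.
Qed.

Lemma rpos_pt i j : (i <= j < i + n)%N -> rpos (pt i) (pt j) = (j - i)%N.
Proof.
move=> ij; rewrite /rpos.
case: (val_pt_cases ij) => -[h ->]; have := ltn_ord (pt i); move=> h'.
  have -> : (pt i + (j - i) + n - pt i = j - i + n)%N by lia.
  by rewrite modnDr modn_small //; lia.
have -> : (pt i + (j - i) - n + n - pt i = j - i)%N by lia.
by rewrite modn_small //; lia.
Qed.

Lemma pt_lift i a : exists2 k, (i <= k < i + n)%N & a = pt k.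
Proof.
have := ltn_ord a; have ri := ltn_ord (pt i).
case: (leqP (pt i) a) => h ha; [exists (i + (a - pt i))%N|exists (i + (n + a - pt i))%N];
  try lia; apply: ord_inj.
  by case: (@val_pt_cases i (i + (a - pt i))%N) => [|[_ ->]|[+ ->]]; lia.
by case: (@val_pt_cases i (i + (n + a - pt i))%N) => [|[+ ->]|[_ ->]]; lia.
Qed.

Lemma segC a b : seg a b = seg b a.
Proof.
rewrite /seg; case: ltngtP => // e.
by have -> : a = b by apply: val_inj.
Qed.

Lemma seg_eq a b c d : seg a b = seg c d -> (a = c /\ b = d) \/ (a = d /\ b = c).
Proof.
rewrite /seg; case: (a < b)%N; case: (c < d)%N => -[-> ->]; by [left|right].
Qed.

Lemma seg_pairP (s : 'I_n * 'I_n) : (s.1 < s.2)%N -> seg s.1 s.2 = s.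
Proof. by rewrite /seg => ->; case: s. Qed.

Lemma ordS_pt i : ordS (pt i) = pt i.+1.
Proof. by apply: val_inj; rewrite /= /pt /= -addn1 modnDml addn1. Qed.

Lemma ord_pred_pt i : ord_pred (pt i.+1) = pt i.
Proof. by rewrite -ordS_pt ordSK. Qed.

End CyclicIndices.

(** * Segments, triangles and turns about a polygon vertex *)

Section Triangulation.
Variables (n : nat) (D : {set 'I_n * 'I_n}).
Hypotheses (n_ge3 : (3 <= n)%N) (triD : triangulation D).
Implicit Types (c d e i j k : nat).

Let n_gt0 : (0 < n)%N. Proof. exact: leq_trans n_ge3. Qed.
Local Notation o := (pt n_gt0).

Definition joined i j := is_seg D (seg (o i) (o j)).

Lemma joinedC i j : joined i j = joined j i.
Proof. by rewrite /joined segC. Qed.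

Lemma joinedDn i j : joined i (j + n) = joined i j.
Proof. by rewrite /joined ptDn. Qed.

Lemma is_seg_lt s : is_seg D s -> (s.1 < s.2)%N.
Proof.
case/orP=> [/andP[]//|sD].
by have /andP[/andP[/forall_inP/(_ _ sD)/andP[]]] := triD.
Qed.

Lemma is_seg_crossing s t : is_seg D s -> is_seg D t -> ~~ crossing s t.
Proof.
have /andP[/andP[_ /forall_inP nc] _] := triD.
move: s t => [a b] [c d] hs ht; have ls := is_seg_lt hs; have lt := is_seg_lt ht.
have := ltn_ord b; have := ltn_ord d; rewrite /= in ls lt.
case/orP: hs => [|sD]; last case/orP: ht => [|tD].
- by rewrite /is_side /crossing /= ls => h *; apply/negP => /orP[] /and3P[]; lia.
- by rewrite /is_side /crossing /= lt => h *; apply/negP => /orP[] /and3P[]; lia.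
- by have /forall_inP/(_ _ tD) := nc _ sD.
Qed.

(** Otherwise [s] could be added to [D], against maximality. *)
Lemma is_seg_maximal (s : 'I_n * 'I_n) :
  (s.1 < s.2)%N -> (forall t, t \in D -> ~~ crossing s t) -> is_seg D s.
Proof.
move=> ls nos; have /andP[/andP[/forall_inP dg /forall_inP nc] /forallP max] := triD.
apply/negPn/negP; rewrite negb_or => /andP[side sD].
suff h : (D \subset s |: D) && noncrossing (s |: D).
  by have := max (s |: D); rewrite h => /eqP/setP/(_ s); rewrite !inE eqxx (negPf sD).
rewrite subsetUr /=; apply/andP; split.
  apply/forall_inP => t; rewrite !inE => /orP[/eqP->|/dg//].
  by rewrite /is_diag ls.
have crC x y : crossing x y = crossing y x by rewrite /crossing orbC.
apply/forall_inP => t + ; rewrite !inE => /orP[/eqP->|tD].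
  apply/forall_inP => u; rewrite !inE => /orP[/eqP->|/nos//].
  by rewrite /crossing !ltnn.
apply/forall_inP => u; rewrite !inE => /orP[/eqP->|uD]; first by rewrite crC nos.
by have /forall_inP/(_ _ uD) := nc _ tD.
Qed.

Lemma is_side_pt i : is_side (seg (o i) (o i.+1)).
Proof.
rewrite /seg /is_side.
have hS : (i <= i.+1 < i + n)%N by lia.
have := ltn_ord (o i).
case: (val_pt_cases n_gt0 hS); move: (o i) (o i.+1) => a b.
all: by case: (ltnP a b) => /=; lia.
Qed.

Lemma joinedS i : joined i i.+1.
Proof. by rewrite /joined /is_seg is_side_pt. Qed.

Lemma joined_crossing i j k l : (i < j < k)%N -> (k < l < i + n)%N ->
  joined i k -> joined j l -> False.
Proof.
move=> ijk kli ik jl; have /negP := is_seg_crossing ik jl; apply.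
have hj : (i <= j < i + n)%N by lia.
have hk : (i <= k < i + n)%N by lia.
have hl : (i <= l < i + n)%N by lia.
have := ltn_ord (o i).
case: (val_pt_cases n_gt0 hj); case: (val_pt_cases n_gt0 hk); case: (val_pt_cases n_gt0 hl);
rewrite /seg /crossing.
all: move: (o i) (o j) (o k) (o l) => a b c d /=.
all: by case: (ltnP a c); case: (ltnP b d) => /=; lia.
Qed.

(** A diagonal crossing {i,j} has one end strictly inside each of the two arcs, which the window
    starting at [i] turns into inequalities. *)
Lemma joined_maximal i j : (i < j < i + n)%N ->
  (forall p q, (i < p < j)%N -> (j < q < i + n)%N -> ~~ joined p q) -> joined i j.
Proof.
move=> ij nopq; apply: is_seg_maximal.
  have hj : (i <= j < i + n)%N by lia.
  rewrite /seg; case: (ltngtP (o i) (o j)) => //= e.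
  by have := pt_inj hj (@ord_inj _ (o i) (o j) e); lia.
move=> [a b] tD; apply/negP => cr.
have ab : (a < b)%N by have := @is_seg_lt (a, b); rewrite /is_seg tD orbT; apply.
have [p hp ep] := pt_lift n_gt0 i a; have [q hq eq] := pt_lift n_gt0 i b.
have jpq : joined p q by rewrite /joined -ep -eq /seg ab /is_seg tD orbT.
have hj : (i <= j < i + n)%N by lia.
suff [h|h] : ((i < p < j) && (j < q < i + n) \/ (i < q < j) && (j < p < i + n))%N.
- by have /negP := nopq p q (andP h).1 (andP h).2.
- by have /negP := nopq q p (andP h).1 (andP h).2; rewrite joinedC.
move: cr ab; rewrite {}ep {}eq {jpq tD nopq}.
have := ltn_ord (o i).
case: (val_pt_cases n_gt0 hj); case: (val_pt_cases n_gt0 hp); case: (val_pt_cases n_gt0 hq);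
rewrite /seg /crossing.
all: move: (o i) (o j) (o p) (o q) => x y z t /=.
all: by case: (ltnP x y) => /=; lia.
Qed.

(* A segment crossing {d,e} but not {c,d} or {c,e} must end at c, hence separates
   d from e among the neighbours of c. *)
Lemma joined_consecutive c d e : (c < d < e)%N -> (e < c + n)%N ->
  joined c d -> joined c e -> (forall g, (d < g < e)%N -> ~~ joined c g) -> joined d e.
Proof.
move=> cde ec cd ce no; apply: joined_maximal; first by lia.
move=> p q hp hq; apply/negP => pq.
case: (ltngtP q (c + n)%N) => hqc.
- by apply: (@joined_crossing c p e q) => //; lia.
- apply: (@joined_crossing c (q - n) d p) => //; try lia.
  by rewrite joinedC -joinedDn subnK //; lia.
- have /negP := no p hp; apply.
  by move: pq; rewrite hqc joinedDn joinedC.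
Qed.

Lemma last_joined c i e : (i < e)%N -> joined c i ->
  exists2 f, (i <= f < e)%N & joined c f /\ forall g, (f < g < e)%N -> ~~ joined c g.
Proof.
move=> ie ci.
case: (@ex_maxnP (fun f => (i <= f < e)%N && joined c f) e) =>
  [|f /andP[/andP[]]|f /andP[hf cf] mx].
- by exists i; rewrite leqnn ie.
- by lia.
exists f => //; split=> // g hg; apply/negP => cg.
by have := mx g; rewrite cg; lia.
Qed.

(** The apex is the neighbour of [c] just before [e]; the side {c,c+1} ensures that there is one. *)
Lemma joined_apex c e : (c.+1 < e < c + n)%N -> joined c e ->
  exists2 f, (c < f < e)%N & joined c f /\ joined f e.
Proof.
move=> hce ce; have [|f hf [cf no]] := @last_joined c c.+1 e _ (joinedS c); first by lia.
by exists f => //; split=> //; apply: (@joined_consecutive c) => //; lia.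
Qed.

Definition adj_pairs (T : Type) (l : seq T) := zip l (behead l).

Lemma adj_pairs_cat (T : Type) (l1 l2 : seq T) x :
  adj_pairs (l1 ++ x :: l2) = adj_pairs (rcons l1 x) ++ adj_pairs (x :: l2).
Proof.
elim: l1 => [|y l1 IH] //; case: l1 IH => [|z l1] //= IH.
by move: IH; rewrite /adj_pairs /= => ->.
Qed.

Lemma adj_pairs_map (T T' : Type) (h : T -> T') (l : seq T) :
  adj_pairs (map h l) = [seq (h p.1, h p.2) | p <- adj_pairs l].
Proof.
by elim: l => [|x [|y l] IH] //; move: IH; rewrite /adj_pairs /= => ->.
Qed.

Definition fan_nbrs c i j := [seq k <- index_iota i j.+1 | joined c k].

(** The part of the face around [c] that turns anticlockwise from {c,i} to {c,j}, one arrow for each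
    triangle corner passed. *)
Definition rot c i j : seq (gl2A n) :=
  [seq inl (o c, o p.1, o p.2) | p <- adj_pairs (fan_nbrs c i j)].

Lemma rot_shift c i j : rot (c + n) i j = rot c i j.
Proof.
rewrite /rot /fan_nbrs; under eq_filter do rewrite joinedC joinedDn joinedC.
by under eq_map do rewrite ptDn.
Qed.

Lemma rot_shift2 c i j : rot c (i + n) (j + n) = rot c i j.
Proof.
rewrite /rot /fan_nbrs.
have -> : index_iota (i + n) (j + n).+1 = [seq (k + n)%N | k <- index_iota i j.+1].
  rewrite /index_iota addnC (addnC j) -addnS subnDl iotaDl.
  by apply: eq_map => k; rewrite addnC.
rewrite filter_map (@eq_filter _ _ (joined c)); last by move=> k /=; rewrite joinedDn.
rewrite adj_pairs_map -map_comp.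
by apply: eq_map => -[k l] /=; rewrite !ptDn.
Qed.

Lemma rot_nil c i : rot c i i = [::].
Proof. by rewrite /rot /fan_nbrs /index_iota subSnn /=; case: ifP. Qed.

(** The cut must be at a neighbour of [c]: otherwise the arrow between the neighbours on either side
    of [j] would be lost. *)
Lemma rot_cat c j i k : (i <= j <= k)%N -> joined c j -> rot c i k = rot c i j ++ rot c j k.
Proof.
move=> ijk cj; rewrite /rot -map_cat; congr map.
rewrite /fan_nbrs.
have -> : index_iota i k.+1 = index_iota i j ++ j :: index_iota j.+1 k.+1.
  rewrite /index_iota (_ : (k.+1 - i = (j - i) + (k.+1 - j))%N); last by lia.
  rewrite iotaD subnKC; last by lia.
  by rewrite (_ : (k.+1 - j = (k.+1 - j.+1).+1)%N); last by lia.
have -> : index_iota i j.+1 = rcons (index_iota i j) j.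
  have ij : (i <= j)%N by lia.
  by rewrite /index_iota subSn // -addn1 iotaD /= subnKC // cats1.
have -> : index_iota j k.+1 = j :: index_iota j.+1 k.+1.
  by rewrite /index_iota (_ : (k.+1 - j = (k.+1 - j.+1).+1)%N) //; lia.
by rewrite filter_cat filter_rcons /= cj adj_pairs_cat.
Qed.

Lemma rot_one c d e : (d < e)%N -> joined c d -> joined c e ->
  (forall g, (d < g < e)%N -> ~~ joined c g) -> rot c d e = [:: inl (o c, o d, o e)].
Proof.
move=> de cd ce no; rewrite /rot /fan_nbrs.
have -> : index_iota d e.+1 = d :: index_iota d.+1 e ++ [:: e].
  rewrite /index_iota (_ : (e.+1 - d = (e - d.+1 + 1).+1)%N) /=; last by lia.
  by rewrite iotaD /= subnKC.
rewrite /= cd filter_cat /= ce.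
have -> : [seq k <- index_iota d.+1 e | joined c k] = [::] => //.
apply/eqP; rewrite -(negbK (_ == _)) -has_filter; apply/negP => /hasP[g].
by rewrite mem_index_iota => /no /negP.
Qed.

Definition triangle c d e :=
  [&& (c < d)%N, (d < e)%N, (e < c + n)%N, joined c d, joined d e & joined c e].

(** A neighbour of [c] strictly between [d] and [e] would give a segment crossing {d,e}. *)
Lemma rot_triangle c d e : triangle c d e -> rot c d e = [:: inl (o c, o d, o e)].
Proof.
case/and5P=> cd de ec jcd /andP[jde jce]; apply: rot_one => // g hg; apply/negP => cg.
by apply: (@joined_crossing d g e (c + n)) => //; rewrite ?joinedDn 1?joinedC //; lia.
Qed.

Lemma triangle_rot c d e : triangle c d e -> triangle d e (c + n).
Proof.
case/and5P=> cd de ec jcd /andP[jde jce].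
by apply/and5P; split=> //; rewrite ?joinedDn ?(joinedC e) ?(joinedC d) ?jcd ?jce //; lia.
Qed.

(** Induction over a turn: its last arrow belongs to the triangle spanned by {c,j} and the preceding
    neighbour of [c]. *)
Lemma rot_ind c i (P : nat -> seq (gl2A n) -> Prop) :
  joined c i -> (c < i)%N -> P i [::] ->
  (forall d e s, (i <= d)%N -> triangle c d e -> P d s -> P e (rcons s (inl (o c, o d, o e)))) ->
  forall j, (i <= j < c + n)%N -> joined c j -> P j (rot c i j).
Proof.
move=> ci lci P0 PS j; elim/ltn_ind: j => j IH hj cj.
case: (ltngtP i j) => hij; [|by lia|by rewrite -hij rot_nil].
have [f hf [cf no]] := last_joined hij ci.
have tri : triangle c f j.
  have fj : joined f j by apply: (@joined_consecutive c) => //; lia.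
  by apply/and5P; split; rewrite ?cf ?fj ?cj //; lia.
rewrite (@rot_cat c f) //; last by lia.
rewrite (rot_triangle tri) cats1; apply: PS => //; first by lia.
by apply: IH => //; lia.
Qed.

Definition gl2_wt (a : gl2A n) : nat := if a is inl (x, y, z) then rpos y z else 1.

Local Notation pwt := (pweight gl2_wt).

Lemma pwt_rot c i j : (c < i <= j)%N -> (j < c + n)%N -> joined c i -> joined c j ->
  pwt (rot c i j) = (j - i)%N.
Proof.
move=> cij jc ci cj.
apply: (@rot_ind c i (fun j s => (i <= j)%N -> pwt s = (j - i)%N)) => //; try lia.
  by move=> _; rewrite subnn.
move=> d e s id /and5P[cd de ec _ _] IH _.
by rewrite -cats1 pweight_cat IH // /pweight /= rpos_pt; lia.
Qed.

(** * The quiver of a triangulation *)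

Local Notation Q := (gl2_dimer D).

Definition sg i j : gl2V n := inr (seg (o i) (o j)).

Lemma sgC i j : sg i j = sg j i.
Proof. by rewrite /sg segC. Qed.

Lemma sgDn i j : sg i (j + n) = sg i j.
Proof. by rewrite /sg ptDn. Qed.

(** [c + n.-1] stands for the polygon vertex before [c], where natural subtraction would truncate at
    0. *)
Lemma ptDn1 c : ord_pred (o c) = o (c + n.-1).
Proof. by rewrite -(ord_pred_pt n_gt0 (c + n.-1)) -addnS prednK // ptDn. Qed.

Lemma is_ctriP (x y z : 'I_n) : is_ctri D (x, y, z) ->
  [/\ [|| (x < y < z)%N, (y < z < x)%N | (z < x < y)%N],
      is_seg D (seg x y), is_seg D (seg y z) & is_seg D (seg x z)].
Proof.
have sgP (a b : 'I_n) : (a < b)%N -> is_seg D (a, b) -> is_seg D (seg a b) /\ is_seg D (seg b a).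
  by move=> ab; rewrite (segC b) /seg ab.
rewrite /is_ctri /is_tri => /or3P[] /and5P[h1 h2 s1 s2 s3].
all: have [? ?] := sgP _ _ h1 s1; have [? ?] := sgP _ _ h2 s2.
all: have [? ?] := sgP _ _ (ltn_trans h1 h2) s3; split=> //.
all: by rewrite h1 h2 ?orbT.
Qed.

Lemma triangle_ctri c d e : triangle c d e -> is_ctri D (o c, o d, o e).
Proof.
case/and5P=> cd de ec jcd /andP[jde jce].
have hd : (c <= d < c + n)%N by lia.
have he : (c <= e < c + n)%N by lia.
have := ltn_ord (o c); move: jcd jde jce; rewrite /joined /is_ctri /is_tri.
case: (val_pt_cases n_gt0 hd); case: (val_pt_cases n_gt0 he).
all: move: (o c) (o d) (o e) => x y z [h1 h2] [h3 h4].
- have [xy yz] : (x < y)%N /\ (y < z)%N by lia.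
  by rewrite /seg xy yz (ltn_trans xy yz) => -> -> ->.
- have [zx xy] : (z < x)%N /\ (x < y)%N by lia.
  by rewrite (segC y) (segC x z) /seg zx xy (ltn_trans zx xy) => -> -> ->; rewrite !orbT.
(* The later corner [e] cannot stay below [n] once [d] has wrapped past it. *)
- by clear -h1 h3 de; lia.
- have [yz zx] : (y < z)%N /\ (z < x)%N by lia.
  by rewrite (segC x y) (segC x z) /seg zx yz (ltn_trans yz zx) => -> -> ->; rewrite !orbT.
Qed.

Lemma ctri_triangle c d (z : 'I_n) : (c < d < c + n)%N -> is_ctri D (o c, o d, z) ->
  exists2 e, triangle c d e & z = o e.
Proof.
move=> hcd /is_ctriP[cyc j1 j2 j3]; have [e he ez] := pt_lift n_gt0 c z.
exists e => //; rewrite {}ez in cyc j2 j3.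
rewrite /triangle /joined j1 j2 j3.
have hd : (c <= d < c + n)%N by lia.
have := ltn_ord (o c); move: cyc.
case: (val_pt_cases n_gt0 hd); case: (val_pt_cases n_gt0 he); case => h1 h2 [h3 h4].
all: by rewrite h2 h4; lia.
Qed.

Lemma joined_irrefl c : joined c c = false.
Proof.
by apply/negP => /is_seg_lt; rewrite /seg ltnn /= ltnn.
Qed.

(** Both lists have the same elements and are sorted by anticlockwise distance from [o c], which is
    antisymmetric there; hence they coincide. *)
Lemma nbrs_pt c : nbrs D (o c) = [seq o k | k <- fan_nbrs c c.+1 (c + n.-1)].
Proof.
have mem_fan k : k \in fan_nbrs c c.+1 (c + n.-1) -> (c <= k < c + n)%N.
  by rewrite mem_filter mem_index_iota => /andP[_]; lia.
apply: (@sorted_eq _ (fun a b => rpos (o c) a <= rpos (o c) b)%N).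
- by move=> x y z; apply: leq_trans.
- move=> x y /anti_leq.
  have [i hi ->] := pt_lift n_gt0 c x; have [j hj ->] := pt_lift n_gt0 c y.
  by rewrite !rpos_pt // => ij; congr o; lia.
- by apply: sort_sorted => x y; apply: leq_total.
- rewrite sorted_map; apply: (@sub_in_sorted _ (fun k => c <= k < c + n)%N ltn).
  + by move=> i j hi hj /=; rewrite !rpos_pt //; lia.
  + by apply/allP => k /mem_fan.
  + by apply: sorted_filter; [exact: ltn_trans | exact: iota_ltn_sorted].
rewrite perm_sort; apply: uniq_perm.
- by rewrite filter_uniq ?enum_uniq.
- rewrite map_inj_in_uniq ?filter_uniq ?iota_uniq // => i j /mem_fan hi /mem_fan hj ij.
  by have := rpos_pt n_gt0 hi; rewrite ij rpos_pt //; lia.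
move=> x; rewrite mem_filter mem_enum andbT; apply/idP/mapP => [cx|[k]].
  have [i hi ei] := pt_lift n_gt0 c x; exists i => //.
  have ci : joined c i by rewrite /joined -ei.
  rewrite mem_filter ci mem_index_iota /=.
  suff : c != i by lia.
  by apply/eqP => e; move: ci; rewrite -e joined_irrefl.
by rewrite mem_filter => /andP[ck _] ->.
Qed.

Lemma vface_pt c :
  vface D (o c) = inr (inl (o c)) :: rot c c.+1 (c + n.-1) ++ [:: inr (inr (o c))].
Proof.
rewrite /vface nbrs_pt; congr (_ :: _ ++ _).
by rewrite -/(adj_pairs _) adj_pairs_map -map_comp.
Qed.

Definition goes X s Y := valid_path Q (X, s) && (pend Q (X, s) == Y).

Lemma gl2_closed_arrows : closed_arrows Q.
Proof.
case=> [[[x y] z]|[v|v]]; rewrite !inE //=; first by case/is_ctriP.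
have [c _ ->] := pt_lift n_gt0 0 v.
by rewrite ordS_pt => _; exact: joinedS.
Qed.

Lemma goes_cat X Y Z s t : goes X s Y -> goes Y t Z -> goes X (s ++ t) Z.
Proof.
case/andP=> vs /eqP es /andP[vt /eqP et]; rewrite /goes.
by rewrite (valid_cat _ _ _ gl2_closed_arrows) // vs es vt pend_cat es et eqxx.
Qed.

Lemma goes_nil X : X \in dverts Q -> goes X [::] X.
Proof. by move=> XQ; rewrite /goes /valid_path /pend /= XQ eqxx. Qed.

Lemma sg_dverts c d : joined c d -> sg c d \in dverts Q.
Proof. by rewrite inE. Qed.

Lemma dverts_pt v : inl v \in dverts Q.
Proof. by rewrite inE. Qed.

Lemma goes_arrow a X Y : X \in dverts Q -> a \in darrs Q -> dsrc Q a = X -> dtgt Q a = Y ->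
  goes X [:: a] Y.
Proof. by move=> XQ aQ aX aY; rewrite /goes /valid_path /pend /= XQ aQ -aX -aY !eqxx. Qed.

Lemma goes_triangle c d e : triangle c d e -> goes (sg c d) [:: inl (o c, o d, o e)] (sg c e).
Proof.
move=> tri; have /and5P[_ _ _ cd _] := tri.
apply: goes_arrow => //; first exact: sg_dverts.
by rewrite inE triangle_ctri.
Qed.

Lemma goes_rot c i j : (c < i <= j)%N -> (j < c + n)%N -> joined c i -> joined c j ->
  goes (sg c i) (rot c i j) (sg c j).
Proof.
move=> cij jc ci cj.
apply: (@rot_ind c i (fun j s => goes (sg c i) s (sg c j))) => //; try lia.
  by apply: goes_nil; apply: sg_dverts.
move=> d e s _ tri IH; rewrite -cats1; apply: goes_cat IH _; exact: goes_triangle.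
Qed.

(** [step_out c] leaves the side {c-1,c} for the polygon vertex [c], and [step_in c] goes on into
    the side {c,c+1}. *)
Definition step_out c : seq (gl2A n) := [:: inr (inr (o c))].
Definition step_in c : seq (gl2A n) := [:: inr (inl (o c))].
Definition bstep c := step_out c ++ step_in c.

Lemma goes_step_out c : goes (sg (c + n.-1) c) (step_out c) (inl (o c)).
Proof.
apply: goes_arrow; rewrite ?inE //; last by rewrite /= ptDn1.
by have := joinedS (c + n.-1); rewrite -addnS prednK // joinedDn.
Qed.

Lemma goes_step_outS c : goes (sg c c.+1) (step_out c.+1) (inl (o c.+1)).
Proof.
by have := goes_step_out c.+1; rewrite addSn -addnS prednK // sgC sgDn sgC.
Qed.

Lemma goes_step_in c : goes (inl (o c)) (step_in c) (sg c c.+1).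
Proof. by apply: goes_arrow; rewrite ?inE //= ordS_pt. Qed.

Lemma goes_bstep c : goes (sg (c + n.-1) c) (bstep c) (sg c c.+1).
Proof. exact: goes_cat (goes_step_out c) (goes_step_in c). Qed.

Lemma goes_bstepS c : goes (sg c c.+1) (bstep c.+1) (sg c.+1 c.+2).
Proof. exact: goes_cat (goes_step_outS c) (goes_step_in c.+1). Qed.

Lemma bstepDn c : bstep (c + n) = bstep c.
Proof. by rewrite /bstep /step_out /step_in ptDn. Qed.

Lemma joined_pred c : joined c (c + n.-1).
Proof.
by have := joinedS (c + n.-1); rewrite -addnS prednK // joinedDn joinedC.
Qed.

Lemma goes_vface c : goes (inl (o c)) (vface D (o c)) (inl (o c)).
Proof.
rewrite vface_pt -cat1s; apply: goes_cat (goes_step_in c) _.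
apply: goes_cat (_ : goes _ _ (sg c (c + n.-1))) _; last by rewrite sgC; apply: goes_step_out.
by apply: goes_rot; rewrite ?joinedS ?joined_pred //; lia.
Qed.

(** The two boundary arrows contribute 1 each, the turn between them [n - 2]. *)
Lemma pwt_vface c : pwt (vface D (o c)) = n.
Proof.
rewrite vface_pt /pweight /= -/(pweight _ _) pweight_cat pwt_rot ?joinedS ?joined_pred //; try lia.
by rewrite /pweight /=; lia.
Qed.

Lemma goes_bound X s Y : goes X s Y -> walk Q X s /\ pend Q (X, s) = Y.
Proof. by case/andP => /and3P[_ _ ?] /eqP. Qed.

(** The other arrows lead from the target of [a] back to its source, so faces of equal weight give
    both sides of a relation the same class. *)
Lemma face_rest_pclass X (f : seq (gl2A n)) a : walk Q X f -> pend Q (X, f) = X -> a \in f ->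
  pclass Q gl2_wt (dtgt Q a, face_rest f a) = (dtgt Q a, dsrc Q a, (pwt f - gl2_wt a)%N).
Proof.
move=> wf ef af; rewrite /face_rest.
have ia : (index a f < size f)%N by rewrite index_mem.
have fE : f = take (index a f) f ++ a :: drop (index a f).+1 f.
  by rewrite -{2}(nth_index a af) -drop_nth // cat_take_drop.
move: {af ia} (take _ f) (drop _ f) fE wf ef => f1 f2 ->.
rewrite walk_cat pend_cat pend_cons /= => /and3P[_ /eqP e1 _] e2.
rewrite /pclass /pstart /= pend_cat e2 -e1 !pweight_cat /pweight /=.
by congr (_, _, _); lia.
Qed.

Lemma mem_rels r : reflect
  (exists a f g, [/\ a \in darrs Q, f \in dacw Q, g \in dcw Q, (a \in f) && (a \in g) &
     r = ((dtgt Q a, face_rest f a), (dtgt Q a, face_rest g a))])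
  (r \in rels Q).
Proof.
apply: (iffP idP).
  case/allpairsPdep=> a [[f g] []]; rewrite mem_enum mem_filter => aQ /andP[afg].
  case/allpairsP=> -[f' g'] /= [fQ gQ [ef eg]] er; exists a, f, g.
  by split; rewrite ?er // ?ef ?eg.
case=> a [f [g [aQ fQ gQ afg ->]]]; apply/allpairsPdep; exists a, (f, g).
by rewrite mem_enum mem_filter /= afg aQ allpairs_f.
Qed.

Lemma walk_tface t : let: (a, b, c) := t in
  walk Q (inr (seg a b)) (tface t) /\ pend Q (inr (seg a b), tface t) = inr (seg a b).
Proof.
by case: t => -[a b] c /=; rewrite /pend /= (segC c a) (segC c b) (segC b a) !eqxx.
Qed.

Lemma rpos_lt (a b : 'I_n) : (a < b)%N -> rpos a b = (b - a)%N.
Proof.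
move=> ab; rewrite /rpos addnC -addnBA; last exact: ltnW.
by rewrite modnDl modn_small //; have := ltn_ord b; lia.
Qed.

Lemma rpos_gt (a b : 'I_n) : (b < a)%N -> rpos a b = (b + n - a)%N.
Proof. by move=> ab; rewrite /rpos modn_small //; have := ltn_ord a; lia. Qed.

Lemma pwt_tface t : is_tri D t -> pwt (tface t) = n.
Proof.
case: t => -[a b] c /and5P[ab bc _ _ _].
rewrite /pweight /= (rpos_lt ab) (rpos_lt bc) rpos_gt; last by lia.
by have := ltn_ord c; lia.
Qed.

Lemma gl2_homogeneous : homogeneous_rels Q gl2_wt.
Proof.
move=> r /mem_rels[a [f [g [aQ /mapP[v _ ->] /mapP[t + ->] /andP[av ag] ->]]]] /=.
rewrite mem_enum inE => tri.
have [c _ ev] := pt_lift n_gt0 0 v; rewrite {v}ev in av *.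
have [w1 e1] := goes_bound (goes_vface c).
have [w2 e2] : walk Q (inr (seg t.1.1 t.1.2)) (tface t) /\
  pend Q (inr (seg t.1.1 t.1.2), tface t) = inr (seg t.1.1 t.1.2).
  by have := walk_tface t; case: (t) => -[].
rewrite (face_rest_pclass w1 e1 av) (face_rest_pclass w2 e2 ag).
by rewrite pwt_vface pwt_tface.
Qed.

(** * Congruences between paths *)

(** Bundling the congruence with validity and both endpoints lets [eqv_cat] compose without side
    conditions. *)
Definition eqv X Y s t := [/\ goes X s Y, goes X t Y & peq Q X s t].

Lemma eqv_refl X Y s : goes X s Y -> eqv X Y s s.
Proof. by move=> gs; split=> //; exact: peq_refl. Qed.

Lemma eqv_sym X Y s t : eqv X Y s t -> eqv X Y t s.
Proof. by case=> gs gt st; split=> //; exact: peq_sym. Qed.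

Lemma eqv_trans X Y s t u : eqv X Y s t -> eqv X Y t u -> eqv X Y s u.
Proof. by case=> gs _ st [_ gu tu]; split=> //; exact: peq_trans st tu. Qed.

Lemma eqv_cat X Y Z s s' t t' : eqv X Y s s' -> eqv Y Z t t' -> eqv X Z (s ++ t) (s' ++ t').
Proof.
case=> gs gs' ss [gt gt' tt]; have cl := gl2_closed_arrows.
split; [exact: goes_cat gs gt | exact: goes_cat gs' gt' |].
have [[vs /eqP es] [vs' /eqP es']] := (andP gs, andP gs').
have [vt _] := andP gt.
apply: (@peq_trans _ _ _ _ _ (s' ++ t)).
  by apply: peq_catr => //; rewrite es.
by apply: peq_catl => //; rewrite es'.
Qed.

Lemma face_rest_split (f1 f2 : seq (gl2A n)) a :
  a \notin f1 -> face_rest (f1 ++ a :: f2) a = f2 ++ f1.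
Proof.
move=> af1; rewrite /face_rest index_cat (negPf af1) /= eqxx addn0.
by rewrite take_size_cat // -cat_rcons drop_size_cat // size_rcons.
Qed.

(** [face_rest] cuts at the first occurrence of an arrow; this locates that occurrence. *)
Lemma rot_notin c d e : triangle c d e -> inl (o c, o d, o e) \notin rot c c.+1 d.
Proof.
case/and5P=> cd de ec jcd _.
apply: (@rot_ind c c.+1 (fun j s => j <= d -> inl (o c, o d, o e) \notin s)%N) => //;
  try lia; first exact: joinedS.
move=> d' e' s cd' /and5P[_ de' _ _ _] IH e'd; rewrite mem_rcons inE negb_or IH ?andbT; last by lia.
apply/eqP => -[dd _].
by have := @pt_inj _ n_gt0 d' d _ (@ord_inj _ (o d') (o d) (esym dd)); lia.
Qed.

Lemma triangle_cases c d e : triangle c d e ->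
  [/\ joined c d, joined d e, joined c e, c < d < e & e < c + n]%N.
Proof. by case/and5P=> -> -> -> -> /andP[-> ->]. Qed.

(** Closing the face up cyclically joins its last and first arrows into [bstep c]. *)
Lemma vface_rest c d e : triangle c d e ->
  (inl (o c, o d, o e) \in vface D (o c)) /\
  face_rest (vface D (o c)) (inl (o c, o d, o e)) =
    rot c e (c + n.-1) ++ bstep c ++ rot c c.+1 d.
Proof.
move=> tri; have [jcd jde jce cde ec] := triangle_cases tri.
have -> : vface D (o c) = (step_in c ++ rot c c.+1 d) ++
    inl (o c, o d, o e) :: (rot c e (c + n.-1) ++ step_out c).
  rewrite vface_pt (@rot_cat c d) //; last by lia.
  rewrite (@rot_cat c e d) //; last by lia.
  by rewrite (rot_triangle tri) /= -!catA.
split; first by rewrite mem_cat [X in _ || X]in_cons eqxx orbT.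
rewrite face_rest_split; first by rewrite /bstep -!catA.
by rewrite mem_cat negb_or rot_notin.
Qed.

Lemma tface_rest c d e : triangle c d e -> exists2 g, g \in dcw Q &
  (inl (o c, o d, o e) \in g) /\
  face_rest g (inl (o c, o d, o e)) = [:: inl (o e, o c, o d); inl (o d, o e, o c)].
Proof.
move=> tri; have [_ _ _ cde ec] := triangle_cases tri.
have cd : o c != o d by apply: pt_neq; lia.
have de : o d != o e by apply: pt_neq; lia.
have ce : o c != o e by apply: pt_neq; lia.
move: (triangle_ctri tri) cd de ce; rewrite /is_ctri.
move: (o c) (o d) (o e) => x y z; rewrite {tri cde ec} => ctri xy yz xz.
have mem_tface t : is_tri D t -> tface t \in dcw Q.
  by move=> tt; apply: map_f; rewrite mem_enum inE.
(* [tface] is listed from the smallest corner, so the arrow stands at position 0, 1 or 2 according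
   to the case. *)
case/or3P: ctri => /mem_tface tQ; eexists; try exact: tQ; split.
- by rewrite /tface !inE eqxx.
- exact: (face_rest_split (f1 := [::])).
- by rewrite /tface !inE eqxx !orbT.
- apply: (face_rest_split (f1 := [:: inl (y, z, x)])); rewrite !inE.
  by apply/eqP => -[exy _ _]; rewrite exy eqxx in xy.
- by rewrite /tface !inE eqxx !orbT.
- apply: (face_rest_split (f1 := [:: inl (z, x, y); inl (y, z, x)])); rewrite !inE negb_or.
  by apply/andP; split; apply/eqP => -[exy _ _]; [rewrite exy eqxx in xz | rewrite exy eqxx in xy].
Qed.

(** The relation of the arrow from {c,d} to {c,e}: returning around the triangle equals returning
    around the face of [c]. All later congruences are built from these. *)
Lemma eqv_triangle c d e : triangle c d e ->
  eqv (sg c e) (sg c d) [:: inl (o e, o c, o d); inl (o d, o e, o c)]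
    (rot c e (c + n.-1) ++ bstep c ++ rot c c.+1 d).
Proof.
move=> tri; have [jcd jde jce cde ec] := triangle_cases tri.
have tri1 := triangle_rot tri; have tri2 := triangle_rot tri1.
have g1 : goes (sg c e) [:: inl (o e, o c, o d); inl (o d, o e, o c)] (sg c d).
  rewrite -cat1s; apply: (@goes_cat _ (sg e d)).
    by have := goes_triangle tri2; rewrite !sgDn !ptDn sgC.
  by have := goes_triangle tri1; rewrite !sgDn !ptDn sgC (sgC d).
split=> //.
  apply: (@goes_cat _ (sg c (c + n.-1))).
    by apply: goes_rot => //; rewrite ?joined_pred //; lia.
  rewrite sgC; apply: goes_cat (goes_bstep c) _.
  by apply: goes_rot => //; rewrite ?joinedS //; lia.
have [av <-] := vface_rest tri; have [g gQ [ag gE]] := tface_rest tri.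
have aQ : inl (o c, o d, o e) \in darrs Q by rewrite inE triangle_ctri.
pose a : gl2A n := inl (o c, o d, o e).
pose r := ((dtgt Q a, face_rest (vface D (o c)) a), (dtgt Q a, face_rest g a)).
have rQ : r \in rels Q.
  apply/mem_rels; exists a, (vface D (o c)), g; split=> //; last by rewrite av ag.
  by apply: map_f; rewrite mem_enum.
have e12 : pend Q r.1 = pend Q r.2 := congr1 (fun t => t.1.2) (gl2_homogeneous rQ).
have e1 : pend Q r.1 = sg c d by rewrite e12 /r gE; case/andP: g1 => _ /eqP.
have := @peq_rel _ _ Q (sg c e) [::] r [::] rQ; rewrite /= !cats0 gE => H.
apply: peq_sym; apply: H => //.
- by case/andP: (goes_nil (sg_dverts jce)).
- by rewrite e1; case/andP: (goes_nil (sg_dverts jcd)).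
- by rewrite -gE.
Qed.

(* The m boundary steps from the side {c,c+1} to {c+m,c+m+1}. *)
Fixpoint bwalk c m : seq (gl2A n) :=
  if m is m'.+1 then bwalk c m' ++ bstep (c + m) else [::].

Lemma bwalkS c m : bwalk c m.+1 = bwalk c m ++ bstep (c + m).+1.
Proof. by rewrite /= addnS. Qed.

Lemma bwalkD c m k : bwalk c (m + k) = bwalk c m ++ bwalk (c + m) k.
Proof.
by elim: k => [|k IH]; rewrite ?addn0 ?cats0 // addnS !bwalkS IH -catA addnA.
Qed.

Lemma goes_bwalk c m : goes (sg c c.+1) (bwalk c m) (sg (c + m) (c + m).+1).
Proof.
elim: m => [|m IH]; first by rewrite addn0; apply: goes_nil; apply/sg_dverts/joinedS.
by rewrite bwalkS addnS; apply: goes_cat IH _; apply: goes_bstepS.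
Qed.

Lemma pwt_bwalk c m : pwt (bwalk c m) = m.*2.
Proof.
by elim: m => // m IH; rewrite bwalkS pweight_cat IH /pweight /= doubleS addn2.
Qed.

(* Turning about c from its side to {c,e} and then about e back down to the side
   {e-1,e}, where e = c+m+1, is the same as walking along the boundary. *)
Definition ear c m := eqv (sg c c.+1) (sg (c + m) (c + m).+1)
  (rot c c.+1 (c + m).+1 ++ rot (c + m).+1 (c + n) (c + m + n)) (bwalk c m).

(** The last arrow about [c] and the arrow about [e] are two arrows of one triangle; the relation of
    the third, at [f], replaces them by a turn about [f] through the boundary. The beginning of that
    turn completes the ear over {c,f}. *)
Lemma ear_swing c m e : triangle c (c + m).+1 e -> ear c m ->
  eqv (sg c c.+1) (sg (c + m).+1 e)
    (rot c c.+1 e ++ [:: inl (o e, o c, o (c + m).+1)])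
    (bwalk c m.+1 ++ rot (c + m).+1 (c + m).+2 e).
Proof.
set f := (c + m).+1 => tri Hear; have [jcf jfe jce cfe ec] := triangle_cases tri.
have := eqv_triangle (triangle_rot tri); rewrite !ptDn (sgDn f) (sgC f c) => H.
have -> : rot c c.+1 e ++ [:: inl (o e, o c, o f)] =
    rot c c.+1 f ++ [:: inl (o c, o f, o e); inl (o e, o c, o f)].
  rewrite (@rot_cat c f) // ?(rot_triangle tri) -?catA //; rewrite /f; lia.
have gf : goes (sg c c.+1) (rot c c.+1 f) (sg c f).
  by apply: goes_rot => //; rewrite ?joinedS // /f; lia.
apply: eqv_trans (eqv_cat (eqv_refl gf) H) _.
have -> : (f + n.-1 = c + m + n)%N by rewrite /f; lia.
rewrite /ear in Hear; rewrite (catA (rot c c.+1 f)) bwalkS -(catA (bwalk c m)).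
apply: eqv_cat Hear _; apply: eqv_refl.
apply: goes_cat (goes_bstepS _) _.
by apply: goes_rot => //; rewrite ?joinedS //; rewrite /f in cfe *; lia.
Qed.

(** Induction on the polygon cut off by {c,e}: the apex [f] of its triangle on {c,e} splits it into
    the ears over {c,f} and {f,e}, and [ear_swing] supplies the boundary step at [f] between
    them. *)
Lemma joined_ear c m : (m.+1 < n)%N -> joined c (c + m).+1 -> ear c m.
Proof.
elim/ltn_ind: m c => -[|m] IH c mn ce.
  rewrite /ear addn0 /= !rot_nil; apply: eqv_refl; apply: goes_nil.
  exact/sg_dverts/joinedS.
have [|f hf [cf fe]] := joined_apex _ ce; first by lia.
have [k km ek] : exists2 k, (k < m.+1)%N & f = (c + k).+1 by exists (f - c.+1)%N; lia.
have [j ej] : exists j, (m = k + j)%N by exists (m - k)%N; lia.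
subst f m; rewrite /ear; set f := (c + k).+1 in cf fe hf *.
have ef : ((c + (k + j).+1).+1 = (f + j).+1)%N by rewrite /f; lia.
have ef' : (c + (k + j).+1 = f + j)%N by rewrite /f; lia.
rewrite ef ef' in ce fe hf *; set e := (f + j).+1 in ce fe hf *.
have tri : triangle c f e.
  by apply/and5P; split; rewrite ?cf ?fe ?ce //; rewrite /e /f in hf *; lia.
have tri2 := triangle_rot (triangle_rot tri).
have -> : rot e (c + n) (f + j + n) = [:: inl (o e, o c, o f)] ++ rot e (f + n) (f + j + n).
  rewrite (@rot_cat e (f + n)); [|by rewrite /f; lia|by rewrite joinedDn joinedC].
  by rewrite (rot_triangle tri2) !ptDn.
have km' : (k.+1 < n)%N by lia.
have H1 := ear_swing tri (IH k km c km' cf).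
have jn : (j.+1 < n)%N by lia.
have jm : (j < (k + j).+1)%N by lia.
have H2 := IH j jm f jn fe.
rewrite catA -addSn bwalkD addnS.
have gr : goes (sg f e) (rot e (f + n) (f + j + n)) (sg (f + j) e).
  rewrite (sgC f) (sgC (f + j)) -(sgDn e f) -(sgDn e (f + j)).
  by apply: goes_rot; rewrite ?joinedDn 1?joinedC // ?joinedS // /e /f; lia.
apply: eqv_trans (eqv_cat H1 (eqv_refl gr)) _; rewrite -catA.
have gb := goes_bwalk c k.+1; rewrite addnS in gb.
exact: (eqv_cat (eqv_refl gb) (H2 : eqv _ _ _ _)).
Qed.

(** The face around [c], read cyclically from the segment {c,d}. *)
Definition loop c d := rot c d (c + n.-1) ++ bstep c ++ rot c c.+1 d.

Lemma loopDn c d : loop (c + n) (d + n) = loop c d.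
Proof.
rewrite /loop !rot_shift bstepDn -addnAC rot_shift2 -addSn.
by rewrite rot_shift2.
Qed.

Lemma goes_loop c d : (c < d < c + n)%N -> joined c d -> goes (sg c d) (loop c d) (sg c d).
Proof.
move=> hd cd; apply: (@goes_cat _ (sg c (c + n.-1))).
  by apply: goes_rot => //; rewrite ?joined_pred //; lia.
rewrite sgC; apply: goes_cat (goes_bstep c) _.
by apply: goes_rot => //; rewrite ?joinedS //; lia.
Qed.

Lemma loop_triangle c d e : triangle c d e -> eqv (sg c d) (sg c d) (loop c d) (loop d (c + n)).
Proof.
move=> tri; have [jcd jde jce cde ec] := triangle_cases tri.
have tri1 := triangle_rot tri.
have H1 := eqv_cat (eqv_refl (goes_triangle tri)) (eqv_triangle tri).
have g1 : goes (sg d e) [:: inl (o d, o e, o c)] (sg c d).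
  by have := goes_triangle tri1; rewrite sgDn ptDn (sgC d c).
have := eqv_triangle tri1; rewrite sgDn ptDn (sgC d c) => H2.
have {H2} H2 := eqv_cat H2 (eqv_refl g1).
have -> : loop c d = [:: inl (o c, o d, o e)] ++ rot c e (c + n.-1) ++ bstep c ++ rot c c.+1 d.
  by rewrite /loop (@rot_cat c e d) -?(rot_triangle tri) -?catA //; lia.
have -> : loop d (c + n) =
    (rot d (c + n) (d + n.-1) ++ bstep d ++ rot d d.+1 e) ++ [:: inl (o d, o e, o c)].
  rewrite /loop (@rot_cat d e d.+1) -?catA; [|by lia|by []].
  by rewrite (rot_triangle tri1) ptDn.
exact: eqv_trans (eqv_sym H1) H2.
Qed.

(* Both face loops at a segment agree with the cycle of an adjacent triangle. *)
Lemma loop_swap c d : (c < d < c + n)%N -> joined c d ->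
  eqv (sg c d) (sg c d) (loop c d) (loop d (c + n)).
Proof.
move=> hd cd; have [dc|dc] := ltnP d.+1 (c + n)%N.
  have [||f hf [df fc]] := @joined_apex d (c + n); rewrite ?joinedDn 1?joinedC //; try lia.
  have cf : joined c f by rewrite joinedC -joinedDn.
  by apply: (@loop_triangle c d f); apply/and5P; split; rewrite ?cd ?df ?cf //; lia.
(* Now [d = c + n.-1] and no polygon vertex lies beyond [d]; the apex is found between [c] and [d],
   where [n_ge3] leaves room. *)
have [|f hf [cf fd]] := joined_apex _ cd; first by lia.
have tri : triangle c f d by apply/and5P; split; rewrite ?cf ?fd ?cd //; lia.
have := loop_triangle (triangle_rot (triangle_rot tri)).
by rewrite sgDn (sgC d) loopDn => /eqv_sym.
Qed.

(** The loop slides along the boundary: at {d,d+1} it is swapped for the loop about [d.+1], which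
    begins with [bstep d.+1] and so rereads as that step followed by the loop at the next side. *)
Lemma loop_bwalk c m : eqv (sg c c.+1) (sg (c + m) (c + m).+1)
  (loop c c.+1 ++ bwalk c m) (bwalk c m ++ loop (c + m) (c + m).+1).
Proof.
have gl i : goes (sg i i.+1) (loop i i.+1) (sg i i.+1).
  by apply: goes_loop; rewrite ?joinedS //; lia.
elim: m => [|m IH]; first by rewrite cats0 addn0 /=; apply: eqv_refl.
rewrite bwalkS catA addnS; set d := (c + m)%N in IH *.
apply: eqv_trans (eqv_cat IH (eqv_refl (goes_bstepS d))) _.
rewrite -!(catA (bwalk c m)); apply: eqv_cat (eqv_refl (goes_bwalk c m)) _.
have -> : bstep d.+1 ++ loop d.+1 d.+2 = loop d.+1 (d + n) ++ bstep d.+1.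
  by rewrite /loop (_ : (d.+1 + n.-1 = d + n)%N) ?rot_nil ?cats0 -?catA //; lia.
apply: eqv_cat (loop_swap _ (joinedS d)) (eqv_refl (goes_bstepS d)); lia.
Qed.

(** Moves a loop from the end of a canonical path to its start, where all loops are gathered. *)
Lemma loop_canon v c d : (v <= c < d)%N -> (d < c + n)%N -> joined c d ->
  eqv (sg v v.+1) (sg c d) (bwalk v (c - v) ++ rot c c.+1 d ++ loop c d)
    (loop v v.+1 ++ bwalk v (c - v) ++ rot c c.+1 d).
Proof.
move=> vcd dc cd.
have gr : goes (sg c c.+1) (rot c c.+1 d) (sg c d).
  by apply: goes_rot => //; rewrite ?joinedS //; lia.
have -> : rot c c.+1 d ++ loop c d = loop c c.+1 ++ rot c c.+1 d.
  by rewrite /loop rot_nil cats0 -!catA (@rot_cat c d c.+1 (c + n.-1)) -?catA //; lia.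
have := loop_bwalk v (c - v); rewrite subnKC; last by lia.
move=> /eqv_sym H; rewrite (catA _ (loop c c.+1)) (catA (loop v v.+1)).
exact: eqv_cat H (eqv_refl gr).
Qed.

(** * Canonical paths *)

(** Minimum and maximum reorder the endpoints as seen from [v]. The base [v] itself is reached by
    turning about it, at weight [n.-1]; walking around the boundary would cost one loop more. *)
Definition canon v (Y : gl2V n) : seq (gl2A n) :=
  match Y with
  | inl w => if rpos (o v) w == 0%N then rot v v.+1 (v + n.-1) ++ [:: inr (inr w)]
             else bwalk v (rpos (o v) w).-1 ++ [:: inr (inr w)]
  | inr (a, b) =>
      let r := minn (rpos (o v) a) (rpos (o v) b) in
      let r' := maxn (rpos (o v) a) (rpos (o v) b) in
      bwalk v r ++ rot (v + r) (v + r).+1 (v + r')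
  end.

(** The formula does not mention [D], which is what allows two triangulations to be compared. *)
Definition canon_wt v (Y : gl2V n) : nat :=
  match Y with
  | inl w => if rpos (o v) w == 0%N then n.-1 else ((rpos (o v) w).-1).*2.+1
  | inr (a, b) =>
      let r := minn (rpos (o v) a) (rpos (o v) b) in
      let r' := maxn (rpos (o v) a) (rpos (o v) b) in r.*2 + (r' - r).-1
  end.

Lemma canon_pt0 v : canon v (inl (o v)) = rot v v.+1 (v + n.-1) ++ step_out v.
Proof. by rewrite /canon rpos_pt ?subnn //; lia. Qed.

Lemma canon_pt v w : (v < w < v + n)%N ->
  canon v (inl (o w)) = bwalk v (w - v).-1 ++ step_out w.
Proof. by move=> vw; rewrite /canon rpos_pt; last lia; case: eqP => //; lia. Qed.

Lemma canon_sg v c d : (v <= c < d)%N -> (d < v + n)%N ->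
  canon v (sg c d) = bwalk v (c - v) ++ rot c c.+1 d.
Proof.
move=> vcd dv; rewrite /canon /sg /seg.
have hc : (v <= c < v + n)%N by lia.
have hd : (v <= d < v + n)%N by lia.
have [e1 e2] : (minn (c - v) (d - v) = c - v /\ maxn (c - v) (d - v) = d - v)%N by lia.
have [e3 e4] : (v + (c - v) = c /\ v + (d - v) = d)%N by lia.
by case: ifP => _; rewrite !rpos_pt // 1?(minnC (d - v)) 1?(maxnC (d - v)) e1 e2 e3 e4.
Qed.

Lemma dvertsP v (Y : gl2V n) : Y \in dverts Q ->
  (exists2 w, (v <= w < v + n)%N & Y = inl (o w)) \/
  (exists c d, [/\ (v <= c < d)%N, (d < v + n)%N, joined c d & Y = sg c d]).
Proof.
rewrite inE; case: Y => [w _|s hs].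
  by left; have [k hk ->] := pt_lift n_gt0 v w; exists k.
right; have es := seg_pairP (is_seg_lt hs).
have [c hc ec] := pt_lift n_gt0 v s.1; have [d hd ed] := pt_lift n_gt0 v s.2.
have cd : joined c d by rewrite /joined -ec -ed es.
have Ys : inr s = sg c d by rewrite /sg -ec -ed es.
case: (ltngtP c d) => h; [exists c, d|exists d, c|].
- by split=> //; lia.
- by split=> //; [lia|lia|rewrite joinedC|rewrite sgC].
- by move: cd; rewrite h joined_irrefl.
Qed.

Lemma goes_canon v Y : Y \in dverts Q -> goes (sg v v.+1) (canon v Y) Y.
Proof.
move=> YQ; have [[w hw ->]|[c [d [vcd dv cd ->]]]] := dvertsP v YQ.
  have [vw|] := ltnP v w; last first.
    move=> wv; have -> : w = v by lia.
    rewrite canon_pt0; apply: goes_cat (_ : goes _ _ (sg v (v + n.-1))) _.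
      by apply: goes_rot; rewrite ?joinedS ?joined_pred //; lia.
    by rewrite sgC; apply: goes_step_out.
  rewrite canon_pt; last by lia.
  apply: goes_cat (goes_bwalk _ _) _.
  have -> : (v + (w - v).-1 = w.-1)%N by lia.
  have := goes_step_outS w.-1.
  by rewrite prednK //; lia.
rewrite canon_sg //; apply: goes_cat (goes_bwalk _ _) _.
rewrite subnKC; last by lia.
by apply: goes_rot => //; rewrite ?joinedS //; lia.
Qed.

Lemma pwt_canon v Y : Y \in dverts Q -> pwt (canon v Y) = canon_wt v Y.
Proof.
move=> YQ; have [[w hw ->]|[c [d [vcd dv cd ->]]]] := dvertsP v YQ.
  rewrite /canon /canon_wt rpos_pt //; case: eqP => _.
    rewrite pweight_cat pwt_rot ?joinedS ?joined_pred //; try lia.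
    by rewrite /pweight /=; lia.
  by rewrite pweight_cat pwt_bwalk /pweight /= addn1.
rewrite canon_sg // pweight_cat pwt_bwalk pwt_rot ?joinedS //; try lia.
rewrite /canon_wt /sg /seg.
have hc : (v <= c < v + n)%N by lia.
have hd : (v <= d < v + n)%N by lia.
by case: ifP => _; rewrite !rpos_pt //; lia.
Qed.

Definition loops v k := flatten (nseq k (loop v v.+1)).

Lemma loopsD v k m : loops v (k + m) = loops v k ++ loops v m.
Proof. by rewrite /loops nseqD flatten_cat. Qed.

Lemma loops1 v : loops v 1 = loop v v.+1.
Proof. exact: cats0. Qed.

Lemma goes_loops v k : goes (sg v v.+1) (loops v k) (sg v v.+1).
Proof.
elim: k => [|k IH]; first by apply: goes_nil; apply/sg_dverts/joinedS.
by apply: goes_cat IH; apply: goes_loop; rewrite ?joinedS //; lia.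
Qed.

Lemma pwt_loops v k : pwt (loops v k) = (k * n)%N.
Proof.
elim: k => // k IH; rewrite -add1n loopsD loops1 pweight_cat IH mulnDl mul1n.
rewrite /loop rot_nil cats0 pweight_cat pwt_rot ?joinedS ?joined_pred //; try lia.
by rewrite /pweight /=; lia.
Qed.

Lemma canon_forward v c d e : (v <= c < d)%N -> (e < v + n)%N -> triangle c d e ->
  eqv (sg v v.+1) (sg c e) (canon v (sg c d) ++ [:: inl (o c, o d, o e)]) (canon v (sg c e)).
Proof.
move=> vcd ev tri; have [jcd jde jce cde ec] := triangle_cases tri.
rewrite canon_sg //; last by lia.
rewrite -catA -(rot_triangle tri) -(@rot_cat c d c.+1 e) //; last by lia.
rewrite -canon_sg //; last by lia.
by apply: eqv_refl; apply: goes_canon; apply: sg_dverts.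
Qed.

(* When the moving endpoint passes the base v, the boundary walk from e to c is
   traded for turns about e and c; the latter completes a full loop. *)
Lemma canon_wrap v c d e : (v <= e < c)%N -> (c < d < v + n)%N -> triangle c d (e + n) ->
  eqv (sg v v.+1) (sg e c) (canon v (sg c d) ++ [:: inl (o c, o d, o e)])
    (loops v 1 ++ canon v (sg e c)).
Proof.
move=> vec cdv tri; have [jcd jde jce cde ec] := triangle_cases tri.
have jec : joined e c by rewrite joinedC -joinedDn.
have [m ec' em] : exists2 m, (c = (e + m).+1)%N & (c - v = e - v + m.+1)%N.
  by exists (c - e.+1)%N; lia.
have [mn hec hv] : [/\ m.+1 < n, e < c < e + n & v <= e]%N by split; lia.
have hem : (e + m + n = c + n.-1)%N by lia.
have [h1 h2] : (v <= c < d)%N /\ (d < v + n)%N by lia.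
have [h3 h4] : (v <= e < c)%N /\ (c < v + n)%N by lia.
have [h5 h6] : (c.+1 <= d <= e + n)%N /\ (c < c.+1 <= e + n)%N by lia.
have [h7 h8] : (e + n < c + n)%N /\ (e < e.+1 <= c)%N by lia.
have h9 : (c < e + n)%N by lia.
clear vec cdv.
have gb : goes (sg v v.+1) (bwalk v (e - v)) (sg e e.+1).
  by have := goes_bwalk v (e - v); rewrite subnKC.
rewrite !canon_sg // loops1 -(ptDn n_gt0 e) -catA -(rot_triangle tri) -(@rot_cat c d c.+1) //.
have jear : joined e (e + m).+1 by rewrite -ec'.
have Hear : eqv _ _ _ _ := joined_ear mn jear; rewrite -ec' in Hear.
have gr : goes (sg (e + m) c) (bstep c ++ rot c c.+1 (e + n)) (sg e c).
  apply: (@goes_cat _ (sg c c.+1)).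
    by rewrite {2 3}ec' ec'; apply: goes_bstepS.
  rewrite (sgC e) -(sgDn c e).
  by apply: goes_rot => //; rewrite ?joinedS.
have H := eqv_cat (eqv_refl gb) (eqv_cat (eqv_sym Hear) (eqv_refl gr)).
rewrite em bwalkD subnKC // bwalkS -ec' -!(catA _ _ (rot _ _ _)).
apply: eqv_trans H _.
have -> : (rot e e.+1 c ++ rot c (e + n) (e + m + n)) ++ bstep c ++ rot c c.+1 (e + n) =
    rot e e.+1 c ++ loop c (e + n) by rewrite /loop -catA hem.
have gr2 : goes (sg e e.+1) (rot e e.+1 c) (sg e c).
  by apply: goes_rot => //; rewrite ?joinedS.
apply: eqv_trans (eqv_cat (eqv_refl gb) (eqv_cat (eqv_refl gr2) (eqv_sym (loop_swap hec jec)))) _.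
exact: loop_canon.
Qed.

(** Here the endpoint nearer to the base moves, about [d]; [ear_swing] converts this into a longer
    boundary walk. *)
Lemma canon_swing v c d e : (v <= c < e)%N -> (e < d < v + n)%N -> triangle c e d ->
  eqv (sg v v.+1) (sg e d) (canon v (sg c d) ++ [:: inl (o d, o c, o e)]) (canon v (sg e d)).
Proof.
move=> vce edv tri; have [jce jed jcd ced dc] := triangle_cases tri.
rewrite canon_sg; [|by lia|by lia]; rewrite canon_sg; [|by lia|by lia].
have [m ec' em] : exists2 m, (e = (c + m).+1)%N & (e - v = c - v + m.+1)%N.
  by exists (e - c.+1)%N; lia.
have mn : (m.+1 < n)%N by lia.
rewrite em bwalkD subnKC; last by lia.
have gb : goes (sg v v.+1) (bwalk v (c - v)) (sg c c.+1).
  by have := goes_bwalk v (c - v); rewrite subnKC //; lia.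
rewrite ec' in tri jce *.
by have := eqv_cat (eqv_refl gb) (ear_swing tri (joined_ear mn jce)); rewrite !catA.
Qed.

(* The last side {v-1,v} is reached more cheaply by turning about v than by
   walking along the boundary; the difference is one loop. *)
Lemma canon_close v : let w := (v + n.-1)%N in
  eqv (sg v v.+1) (sg v w) (canon v (inl (o w)) ++ step_in w) (loops v 1 ++ canon v (sg v w)).
Proof.
move=> w.
have jvw : joined v w := joined_pred v.
have [m wm mn] : exists2 m, (w = (v + m).+1)%N & ((w - v).-1 = m)%N.
  by exists (n - 2)%N; rewrite /w; lia.
have mn' : (m.+1 < n)%N by rewrite /w in wm; lia.
rewrite canon_pt; last by rewrite /w; lia.
rewrite -catA mn canon_sg; [|by rewrite /w; lia|by rewrite /w; lia].
rewrite subnn loops1 /=.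
have jear : joined v (v + m).+1 by rewrite -wm.
have Hear : eqv _ _ _ _ := joined_ear mn' jear; rewrite -wm in Hear.
have gs : goes (sg (v + m) w) (bstep w) (sg v w).
  have := goes_bstepS (v + m); rewrite -wm.
  have -> : w.+1 = (v + n)%N by rewrite /w; lia.
  by rewrite sgDn (sgC w v).
apply: eqv_trans (eqv_cat (eqv_sym Hear) (eqv_refl gs)) _.
have gr : goes (sg v v.+1) (rot v v.+1 w) (sg v w).
  by apply: goes_rot; rewrite ?joinedS // /w; lia.
have -> : (rot v v.+1 w ++ rot w (v + n) (v + m + n)) ++ bstep w =
    rot v v.+1 w ++ loop w (v + n).
  have e1 : (v + n = w.+1)%N by rewrite /w; lia.
  have e2 : (v + m + n = w + n.-1)%N by rewrite /w in wm *; lia.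
  by rewrite /loop e2 e1 rot_nil cats0 -catA.
have hvw : (v < w < v + n)%N by rewrite /w; lia.
apply: eqv_trans (eqv_cat (eqv_refl gr) (eqv_sym (loop_swap hvw jvw))) _.
have := @loop_canon v v w; rewrite subnn /=; apply=> //; rewrite /w; lia.
Qed.

Lemma triangleDn c d e : triangle (c + n) (d + n) (e + n) = triangle c d e.
Proof.
rewrite /triangle !ltn_add2r !joinedDn.
by rewrite ![joined (_ + n) _]joinedC !joinedDn (joinedC d c) (joinedC e d) (joinedC e c).
Qed.

(** One loop splits off when a turn carries the far endpoint to the base or past it, and on entering
    {v,v+1} from [v] or {v-1,v} from the polygon vertex before [v]; otherwise none does. *)
Lemma canon_arrow v a : a \in darrs Q -> exists k,
  eqv (sg v v.+1) (dtgt Q a) (canon v (dsrc Q a) ++ [:: a]) (loops v k ++ canon v (dtgt Q a)).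
Proof.
case: a => [[[x y] z]|[w|w]] aQ.
- have ctri : is_ctri D (x, y, z) by move: aQ; rewrite inE.
  have [_ sxy _ _] := is_ctriP ctri.
  have YQ : inr (seg x y) \in dverts Q by rewrite inE.
  have [[w _ //]|[c [d [vcd dv jcd [eY]]]]] := dvertsP v YQ.
  rewrite [dsrc Q _]/= [dtgt Q _]/=.
  rewrite eY -/(sg c d); case: (seg_eq eY) => {sxy eY YQ aQ} -[ex ey];
    rewrite {x}ex {y}ey in ctri *.
    have [|e tri ->] := ctri_triangle _ ctri; first by lia.
    rewrite -/(sg c e); have [_ _ _ cde ec] := triangle_cases tri.
    case: (ltnP e (v + n)) => [ev|ve]; first by exists 0%N; apply: canon_forward.
    exists 1%N; have ee : (e = (e - n) + n)%N by rewrite subnK //; lia.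
    rewrite ee in tri *; rewrite sgDn ptDn (sgC c).
    by apply: canon_wrap => //; lia.
  (* The turn is about [d]: lifting the moving endpoint [c] to [c + n] puts it into the window
     starting at [d], and the new endpoint [e - n] lies between [c] and [d]. *)
  rewrite -(ptDn n_gt0 c) in ctri *.
  have [|e tri ->] := ctri_triangle _ ctri; first by lia.
  have [_ _ _ cde ec] := triangle_cases tri.
  have ee : (e = (e - n) + n)%N by rewrite subnK //; lia.
  rewrite -/(sg d e) ee !ptDn sgDn (sgC d); exists 0%N.
  apply: canon_swing; try lia.
  by have := triangle_rot tri; rewrite {1}ee triangleDn.
- have [k hk ->] := pt_lift n_gt0 v w.
  rewrite [dsrc Q _]/= [dtgt Q _]/= ordS_pt -/(sg k k.+1) -/(step_in k).
  have [kv|kv] := eqVneq k v.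
    exists 1%N; rewrite {k hk}kv loops1 canon_sg //; try lia.
    rewrite canon_pt0 subnn rot_nil !cats0.
    have -> : (rot v v.+1 (v + n.-1) ++ step_out v) ++ step_in v = loop v v.+1.
      by rewrite /loop rot_nil cats0 -catA.
    by apply/eqv_refl/goes_loop; rewrite ?joinedS //; lia.
  have [kn|kn] := eqVneq k (v + n.-1)%N.
    exists 1%N; rewrite {k kv hk}kn.
    have := canon_close v; have -> : (v + n.-1).+1 = (v + n)%N by lia.
    by rewrite sgDn (sgC _ v).
  exists 0%N; have <- : canon v (sg k k.+1) = canon v (inl (o k)) ++ step_in k.
    rewrite canon_sg; [|by lia|by lia]; rewrite canon_pt; last by lia.
    have [m ->] : exists m, k = (v + m.+1)%N by exists (k - v.+1)%N; lia.
    rewrite rot_nil cats0 (_ : (v + m.+1 - v = m.+1)%N) ?bwalkS; last by lia.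
    by rewrite addnS -catA.
  by apply: eqv_refl; apply: goes_canon; apply/sg_dverts/joinedS.
- have [k hk ->] := pt_lift n_gt0 v w; exists 0%N.
  rewrite [dsrc Q _]/= [dtgt Q _]/= ptDn1 -/(sg (k + n.-1) k) -/(step_out k).
  have -> : canon v (sg (k + n.-1) k) ++ step_out k = canon v (inl (o k)).
    have [kv|kv] := eqVneq k v.
      rewrite {k hk}kv sgC canon_sg //; try lia.
      by rewrite canon_pt0 subnn.
    have -> : sg (k + n.-1) k = sg k.-1 k.
      by rewrite (_ : (k + n.-1 = k.-1 + n)%N) 1?sgC ?sgDn 1?sgC //; lia.
    rewrite canon_sg; [|by lia|by lia]; rewrite canon_pt; last by lia.
    rewrite prednK; last by lia.
    by rewrite rot_nil cats0 (_ : (k.-1 - v = (k - v).-1)%N) //; lia.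
  by apply: eqv_refl; apply: goes_canon; rewrite dverts_pt.
Qed.

Lemma canonical_form v s Y : goes (sg v v.+1) s Y ->
  exists k, eqv (sg v v.+1) Y s (loops v k ++ canon v Y).
Proof.
have vQ : sg v v.+1 \in dverts Q by apply/sg_dverts/joinedS.
elim/last_ind: s Y => [|s a IH] Y.
  case/andP=> _ /eqP <-; exists 0%N; have -> : pend Q (sg v v.+1, [::]) = sg v v.+1 by [].
  rewrite canon_sg //; try lia.
  by rewrite subnn rot_nil; apply/eqv_refl/goes_nil.
rewrite -cats1 => /andP[]; rewrite (valid_cat _ _ _ gl2_closed_arrows) //.
rewrite pend_cat => /andP[vs va] /eqP <-.
have gs : goes (sg v v.+1) s (pend Q (sg v v.+1, s)) by rewrite /goes vs eqxx.
have [k Hk] := IH _ gs; case/and3P: va => /= XQ; rewrite !andbT => aQ /eqP ea.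
rewrite -ea in XQ Hk; have [m Hm] := canon_arrow v aQ; exists (k + m)%N.
have ga := goes_arrow XQ aQ erefl erefl.
apply: eqv_trans (eqv_cat Hk (eqv_refl ga)) _; rewrite loopsD -!catA.
exact: eqv_cat (eqv_refl (goes_loops v k)) Hm.
Qed.

Lemma goes_side_eqv v s t Y : goes (sg v v.+1) s Y -> goes (sg v v.+1) t Y ->
  pwt s = pwt t -> eqv (sg v v.+1) Y s t.
Proof.
move=> gs gt st; have [k Hs] := canonical_form gs; have [m Ht] := canonical_form gt.
have [_ _ /(peq_pweight gl2_homogeneous)] := Hs.
have [_ _ /(peq_pweight gl2_homogeneous)] := Ht.
(* Both weights are a multiple of [n] plus the weight of the same canonical path, so the exponents
   agree. *)
rewrite -st !pweight_cat !pwt_loops => -> /eqP.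
rewrite eqn_add2r eqn_pmul2r // => /eqP e.
by rewrite -e in Hs; exact: eqv_trans Hs (eqv_sym Ht).
Qed.

(** [step_in v] is the only arrow leaving a polygon vertex, so such paths reduce to paths starting
    at a side. *)
Lemma goes_pt v s Y : goes (inl (o v)) s Y ->
  (s = [::] /\ Y = inl (o v)) \/
  exists2 s', s = step_in v ++ s' & goes (sg v v.+1) s' Y.
Proof.
case: s => [|a s]; first by case/andP=> _ /eqP <-; left.
rewrite -cat1s => /andP[]; rewrite (valid_cat _ _ _ gl2_closed_arrows) //.
case/andP=> /and3P[_ _ /andP[/eqP aX _]] vs; rewrite pend_cat => ve; right.
have ea : a = inr (inl (o v)) by case: a aX {vs ve} => [[[? ?] ?]|[w|w]] //= [->].
rewrite {a aX}ea in vs ve *; exists s => //.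
by move: vs ve; rewrite /goes /pend /= ordS_pt -/(sg v v.+1) => -> ->.
Qed.

(** * Boundary vertices and the classification of boundary paths *)

Definition boundary_vertex (Y : gl2V n) : bool := if Y is inr s then is_side s else true.

Lemma is_sideP (s : 'I_n * 'I_n) : is_side s -> exists i, s = seg (o i) (o i.+1).
Proof.
case: s => a b /andP[/= ab /orP[/eqP e|/andP[/eqP e1 /eqP e2]]].
  exists a; rewrite pt_val (_ : o a.+1 = b) ?/seg ?ab //.
  by apply: ord_inj; rewrite /= modn_small // -e.
exists b; rewrite pt_val (_ : o b.+1 = a) 1?segC ?/seg ?ab //.
by apply: ord_inj; rewrite /= e2 prednK // modnn e1.
Qed.

Lemma nfaces_inr (b : 'I_n + 'I_n) : nfaces Q (inr b) = 1%N.
Proof.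
rewrite /nfaces count_cat [dacw _]/= [dcw _]/= !count_map.
have -> : count (preim (@tface n) (fun f => inr b \in f)) (enum [set t | is_tri D t]) = 0%N.
  apply/eqP; rewrite -leqn0 leqNgt -has_count; apply/hasPn => -[[x y] z] _.
  by [].
pose w := match b with inl w => w | inr w => w end.
rewrite addn0 (@eq_count _ _ (pred1 w)).
  by have := count_uniq_mem w (enum_uniq 'I_n); rewrite mem_enum enumT.
move=> v /=; rewrite inE mem_cat inE.
have -> : (inr b \in [seq inl (v, p.1, p.2) | p <- zip (nbrs D v) (behead (nbrs D v))]) = false.
  by apply/negP => /mapP[].
by rewrite /w; case: (b) => u; rewrite /= eq_sym /eq_op /= ?orbF.
Qed.

Lemma nfaces_inl t : inl t \in darrs Q -> (1 < nfaces Q (inl t))%N.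
Proof.
move: t => [[x y] z]; rewrite inE => ctri; have [_ sxy _ _] := is_ctriP ctri.
have [c _ ex] := pt_lift n_gt0 0 x; have [d hd ey] := pt_lift n_gt0 c y.
rewrite {x}ex {y}ey in ctri sxy *.
have cd : c != d by apply/eqP => e; move: sxy; rewrite -e -/(joined c c) joined_irrefl.
have [|e tri ->] := ctri_triangle _ ctri; first by lia.
have [av _] := vface_rest tri; have [g gQ [ag _]] := tface_rest tri.
have h1 : has (fun f => inl (o c, o d, o e) \in f) (dacw Q).
  by apply/hasP; exists (vface D (o c)) => //; apply: map_f; rewrite mem_enum.
have h2 : has (fun f => inl (o c, o d, o e) \in f) (dcw Q) by apply/hasP; exists g.
by rewrite /nfaces count_cat; apply: (@leq_add 1 1); rewrite -has_count.
Qed.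

Lemma gl2_is_bvert : is_bvert Q =1 boundary_vertex.
Proof.
move=> Y; apply/exists_inP/idP => [[a aQ /andP[/eqP na]]|].
  case: a aQ na => [t /nfaces_inl ht na|[w|w] _ _]; first by rewrite na in ht.
    have [i _ ->] := pt_lift n_gt0 0 w.
    by rewrite /= ordS_pt => /orP[/eqP<-|/eqP<-] //=; exact: is_side_pt.
  have [i _ ->] := pt_lift n_gt0 0 w.
  rewrite /= ptDn1 => /orP[/eqP<-|/eqP<-] //=.
  by have := is_side_pt (i + n.-1); rewrite -addnS prednK // ptDn.
case: Y => [w _|s /is_sideP[i ->]].
  by exists (inr (inl w)); rewrite ?inE // nfaces_inr /= eqxx.
exists (inr (inl (o i))); rewrite ?inE // nfaces_inr /= ordS_pt.
by rewrite ?eqxx ?orbT.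
Qed.

Lemma bpath_start X s : bpath Q (X, s) -> let Y := pend Q (X, s) in
  (exists2 v, X = sg v v.+1 & goes (sg v v.+1) s Y) \/
  (exists2 v, X = inl (o v) & (s = [::] /\ Y = inl (o v)) \/
     exists2 s', s = step_in v ++ s' & goes (sg v v.+1) s' Y).
Proof.
case/and3P=> vs; rewrite gl2_is_bvert => bX _ /=.
have gs : goes X s (pend Q (X, s)) by rewrite /goes vs eqxx.
case: X bX gs {vs} => [w _|s' /is_sideP[i ->]] gs; last by left; exists i.
have [v _ ew] := pt_lift n_gt0 0 w; rewrite ew in gs *.
by right; exists v => //; apply: goes_pt.
Qed.

Lemma pwt_step_in v s : pwt (step_in v ++ s) = (pwt s).+1.
Proof. by []. Qed.

Lemma goes_step_inl v s Y : goes (sg v v.+1) s Y -> goes (inl (o v)) (step_in v ++ s) Y.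
Proof. exact: goes_cat (goes_step_in v). Qed.

Lemma gl2_complete : complete_weight Q gl2_wt.
Proof.
move=> X s t bs bt eXs; have est : pwt s = pwt t := congr1 snd eXs.
have eY : pend Q (X, s) = pend Q (X, t) := congr1 (fun z => z.1.2) eXs.
have gt : goes X t (pend Q (X, s)) by rewrite /goes eY eqxx andbT; case/and3P: bt.
have := bpath_start bs; move: (pend Q (X, s)) gt {bs bt eXs eY} => Y gt /=.
move=> [[v eX gs]|[v eX gs]]; rewrite {X}eX in gt *.
  by case: (goes_side_eqv gs gt est).
have [[et _]|[t' et gt']] := goes_pt gt; case: gs => [[es _]|[s' es gs']].
- by rewrite et es; apply: peq_refl.
(* A trivial path has weight 0, while a path through [step_in v] has positive weight. *)
- by move: est; rewrite et es pwt_step_in.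
- by move: est; rewrite et es pwt_step_in.
move: est; rewrite et es !pwt_step_in => -[est].
have [_ _] := goes_side_eqv gs' gt' est; have [vv /eqP ev] := andP (goes_step_in v).
rewrite -ev; apply: peq_catl => //; exact: gl2_closed_arrows.
Qed.

End Triangulation.

(** The normal form of the path for [D] is rebuilt in [F] with the same number of loops and the
    canonical path to the same end. *)
Lemma gl2_realizes n (D F : {set 'I_n * 'I_n}) : (3 <= n)%N -> triangulation D ->
  triangulation F -> realizes (gl2_wt (n := n)) (gl2_dimer D) (gl2_dimer F).
Proof.
move=> n3 tD tF [X s] bs.
have bY : boundary_vertex (pend (gl2_dimer D) (X, s)).
  by rewrite -(gl2_is_bvert n3 tD); case/and3P: bs.
have bX : boundary_vertex X by rewrite -(gl2_is_bvert n3 tD); case/and3P: bs.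
suff [t gt ew] : exists2 t, goes F X t (pend (gl2_dimer D) (X, s)) &
    pweight (gl2_wt (n := n)) t = pweight (gl2_wt (n := n)) s.
  exists (X, t); case/andP: gt => vt /eqP et.
  rewrite /bpath vt !(gl2_is_bvert n3 tF) et bY /pstart bX.
  by rewrite /pclass et /= ew.
have YD : pend (gl2_dimer D) (X, s) \in dverts (gl2_dimer D).
  by apply: pend_dverts (gl2_closed_arrows n3 tD) _; case/and3P: bs.
(* A diagonal of [D] need not be a vertex for [F], but a boundary end is a polygon vertex or a side,
   present in every triangulation. *)
have YF : pend (gl2_dimer D) (X, s) \in dverts (gl2_dimer F).
  by move: bY; rewrite inE; case: (pend _ _) => //= e; rewrite /is_seg => ->.
have := bpath_start n3 tD bs.
move: (pend _ _) YD YF {bs bY} => Y YD YF.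
have side v u : goes D (sg n3 v v.+1) u Y -> exists2 t, goes F (sg n3 v v.+1) t Y &
    pweight (gl2_wt (n := n)) t = pweight (gl2_wt (n := n)) u.
  move=> gu; have [k [_ _ /(peq_pweight (gl2_homogeneous n3 tD)) ->]] := canonical_form tD gu.
  exists (loops F n3 v k ++ canon F n3 v Y).
    exact: (goes_cat n3 tF (goes_loops n3 tF v k) (goes_canon n3 tF v YF)).
  by rewrite !pweight_cat (pwt_loops n3 tF) (pwt_loops n3 tD) (pwt_canon n3 tF) ?(pwt_canon n3 tD).
case=> [[v -> /side //]|[v -> [[-> ->]|[s' -> /side[t gt et]]]]].
  exists [::] => //; apply: goes_nil; exact: dverts_pt.
exists (step_in n3 v ++ t); first exact: goes_step_inl.
by rewrite !pwt_step_in et.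
Qed.

Theorem theorem3p9 (C : numClosedFieldType) (n : nat)
  (D F : {set 'I_n * 'I_n}) :
  (3 <= n)%N -> triangulation D -> fan_triangulation F ->
  corner_alg_iso C (gl2_dimer D) (gl2_dimer F).
Proof.
move=> n3 tD /andP[tF _].
apply: (@weighted_corner_iso _ _ _ (gl2_wt (n := n))).
- exact: gl2_closed_arrows.
- exact: gl2_closed_arrows.
- exact: gl2_homogeneous.
- exact: gl2_homogeneous.
- exact: gl2_complete.
- exact: gl2_complete.
- by move=> Y; rewrite !gl2_is_bvert.
- exact: gl2_realizes.
- exact: gl2_realizes.
Qed.
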